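(* Let $K$ be a field of characteristic $0$, let $n=2m+1\ge5$ be odd, and let $x=\sum_{i=1}^{n-1}e_{i,i+1}$ and $y=e_{n-1,1}+e_{n,2}$ in $\mathfrak{gl}(n,K)$. Let $\mathfrak{g}$ denote the Lie algebra generated by $x,y$. Then $\mathfrak{g}=\mathfrak{so}(n,K)$ if $n\neq7$, and $\mathfrak{g}$ is simple of type $G_2$ if $n=7$.
   Context: $e_{i,j}$ denotes the $n\times n$ matrix with a $1$ in position $(i,j)$ and zeros elsewhere; $\mathfrak{gl}(n,K)$ carries the commutator bracket. The Lie algebra generated by $x,y$ is the smallest Lie subalgebra (over $K$) of $\mathfrak{gl}(n,K)$ containing $x$ and $y$. For $n$ odd, $\mathfrak{so}(n,K)$ is realized as the split form $\{z\in\mathfrak{sl}(n,K) : \varphi(z)=z\}$, where $\varphi:\mathfrak{gl}(n,K)\to\mathfrak{gl}(n,K)$ is the linear map with $\varphi(e_{i,j})=(-1)^{i-j+1}e_{n-j+1,n-i+1}$ (equivalently, $zJ+Jz^{T}=0$ with the symmetric matrix $J=\sum_{i=1}^n(-1)^ie_{i,n+1-i}$). ''Of type $G_2$'' means being a split simple Lie algebra over $K$ with root system of type $G_2$. *)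

(* Defs.v *)
From HB Require Import structures.
From mathcomp Require Import all_boot all_order all_algebra.
Set Implicit Arguments.
Unset Strict Implicit.
Unset Printing Implicit Defensive.
Import GRing.Theory.
Local Open Scope ring_scope.

Section LieSubalgebras.
Variables (K : fieldType) (n : nat).
Implicit Types (g h I U V W : {vspace 'M[K]_n}) (a b z : 'M[K]_n).

Definition brk a b : 'M[K]_n := a *m b - b *m a.

Definition lie_subalgebra g : Prop := {in g &, forall a b, brk a b \in g}.

Definition generated_by a b g : Prop :=
  [/\ lie_subalgebra g, a \in g, b \in g &
      forall U, lie_subalgebra U -> a \in U -> b \in U -> (g <= U)%VS].

(* The span [U, V] of all brackets of an element of U with one of V. *)
Definition brkv U V : {vspace 'M[K]_n} :=
  <<[seq brk u v | u <- vbasis U, v <- vbasis V]>>%VS.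

Lemma brk_suml (I : Type) (r : seq I) (F : I -> 'M[K]_n) b :
  brk (\sum_(i <- r) F i) b = \sum_(i <- r) brk (F i) b.
Proof. by rewrite /brk mulmx_suml mulmx_sumr -sumrB. Qed.

Lemma brk_sumr (I : Type) (r : seq I) (F : I -> 'M[K]_n) a :
  brk a (\sum_(i <- r) F i) = \sum_(i <- r) brk a (F i).
Proof. by rewrite /brk mulmx_suml mulmx_sumr -sumrB. Qed.

Lemma brkZl c a b : brk (c *: a) b = c *: brk a b.
Proof. by rewrite /brk -scalemxAl -scalemxAr scalerBr. Qed.

Lemma brkZr c a b : brk a (c *: b) = c *: brk a b.
Proof. by rewrite /brk -scalemxAl -scalemxAr scalerBr. Qed.

Lemma mem_brkv U V a b : a \in U -> b \in V -> brk a b \in brkv U V.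
Proof.
move=> /coord_vbasis -> /coord_vbasis ->.
rewrite brk_suml; apply: memv_suml => i _; rewrite brk_sumr.
apply: memv_suml => j _; rewrite brkZl brkZr; do 2!apply: memvZ.
by apply/memv_span/allpairs_f; rewrite mem_nth ?size_tuple.
Qed.

Lemma brkv_sub U V W :
  (forall a b, a \in U -> b \in V -> brk a b \in W) -> (brkv U V <= W)%VS.
Proof.
move=> sW; apply/span_subvP => _ /allpairsP[[u v] /= [uU vV ->]].
by apply: sW; apply: vbasis_mem.
Qed.

Lemma generated_by_sig a b : {g | generated_by a b g}.
Proof.
pose step U := (U + brkv U U)%VS.
pose L k := iter k step <<[:: a; b]>>%VS.
have sL k : (L k <= L k.+1)%VS by apply: addvSl.
have sub0 k : (L 0%N <= L k)%VS.
  by elim: k => // k IH; apply: subv_trans IH (sL k).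
have inL k c : c \in [:: a; b] -> c \in L k.
  by move=> cab; apply: (subvP (sub0 k)); apply: memv_span.
have smallest U k : lie_subalgebra U -> a \in U -> b \in U -> (L k <= U)%VS.
  move=> lieU aU bU; elim: k => [|k IH].
    by apply/span_subvP => c; rewrite !inE => /orP[] /eqP->.
  rewrite /L iterS -/(L k) subv_add IH; apply: brkv_sub => u v uL vL.
  by apply: lieU; apply: (subvP IH).
have /sigW[k /eqP eqL] : exists k, L k == L k.+1.
  pose d := \dim (fullv : {vspace 'M[K]_n}).
  case: (boolP [exists k : 'I_d.+1, L k == L k.+1]).
    by case/existsP=> k ?; exists k.
  rewrite negb_exists => /forallP neL.
  suff dimL k : (k <= d.+1 -> k <= \dim (L k))%N.
    by have := dimL _ (leqnn _); rewrite leqNgt ltnS dimvS ?subvf.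
  elim: k => // k IH lekd; apply: leq_ltn_trans (IH (ltnW lekd)) _.
  by have := neL (Ordinal lekd); rewrite eqEdim sL -ltnNge.
exists (L k); split; try by apply: inL; rewrite !inE eqxx ?orbT.
- move=> u v uL vL; rewrite eqL; apply: (subvP (addvSr _ _)).
  exact: mem_brkv.
- by move=> U lU aU bU; apply: smallest.
Qed.

Definition lie_gen a b : {vspace 'M[K]_n} := sval (generated_by_sig a b).

Lemma lie_genP a b : generated_by a b (lie_gen a b).
Proof. exact: svalP. Qed.

Definition lie_ideal g I : Prop :=
  (I <= g)%VS /\ forall a b, a \in g -> b \in I -> brk a b \in I.

Definition lie_simple g : Prop :=
  [/\ lie_subalgebra g,
      exists a b, [/\ a \in g, b \in g & brk a b != 0] &
      forall I, lie_ideal g I -> I = 0%VS \/ I = g].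

(* Some term of the lower central series vanishes. *)
Definition lie_nilpotent h : Prop := exists k, iter k (brkv h) h = 0%VS.

Definition cartan_subalgebra g h : Prop :=
  [/\ (h <= g)%VS, lie_subalgebra h, lie_nilpotent h &
      forall a, a \in g -> (forall b, b \in h -> brk a b \in h) -> a \in h].

Definition ad_triangularizable g a : Prop :=
  exists2 e : seq 'M[K]_n, basis_of g e &
    forall i, (i < size e)%N -> brk a e`_i \in <<take i.+1 e>>%VS.

Definition splitting_cartan g h : Prop :=
  cartan_subalgebra g h /\ forall a, a \in h -> ad_triangularizable g a.

Definition is_root g h (alpha : 'Hom(subvs_of h, K^o)) : Prop :=
  alpha != 0 /\
  exists z, [/\ z \in g, z != 0 &
                forall a : subvs_of h, brk (vsval a) z = alpha a *: z].

End LieSubalgebras.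

(* The root system G_2 over K, in the hyperplane of K^3 where the coordinates
   sum to zero.                                                              *)
Definition G2_roots (K : fieldType) : seq 'rV[K]_3 :=
  let e1 : 'rV[K]_3 := delta_mx 0 (inord 0) in
  let e2 : 'rV[K]_3 := delta_mx 0 (inord 1) in
  let e3 : 'rV[K]_3 := delta_mx 0 (inord 2) in
  let s := [:: e1 - e2; e1 - e3; e2 - e3;
               2%:R *: e1 - e2 - e3; 2%:R *: e2 - e1 - e3;
               2%:R *: e3 - e1 - e2] in
  s ++ [seq - v | v <- s].

(* The roots of (g, h) form a root system in the dual of h, taken over K as in
   Bourbaki; an isomorphism of root systems is a linear isomorphism between
   the ambient spaces carrying roots onto roots.                             *)
Definition root_system_G2 (K : fieldType) (n : nat)
    (g h : {vspace 'M[K]_n}) : Prop :=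
  exists f : 'Hom('Hom(subvs_of h, K^o), 'rV[K]_3),
    [/\ lker f = 0%VS, limg f = <<G2_roots K>>%VS &
        forall alpha, is_root g alpha <-> f alpha \in G2_roots K].

Definition simple_of_type_G2 (K : fieldType) (n : nat)
    (g : {vspace 'M[K]_n}) : Prop :=
  lie_simple g /\ exists h, splitting_cartan g h /\ root_system_G2 g h.

(* Matrix units with indices starting from 1. *)
Definition E (K : fieldType) (n i j : nat) : 'M[K]_n :=
  \matrix_(a < n, b < n) ((a.+1 == i) && (b.+1 == j))%:R.

Definition xmx (K : fieldType) (n : nat) : 'M[K]_n :=
  \sum_(1 <= i < n) E K n i i.+1.

Definition ymx (K : fieldType) (n : nat) : 'M[K]_n :=
  E K n n.-1 1%N + E K n n 2%N.

(* Ordinals start from 0, so rev_ord j stands for the index n - j + 1. *)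
Definition phi (K : fieldType) (n : nat) (z : 'M[K]_n) : 'M[K]_n :=
  \sum_(i < n) \sum_(j < n)
     z i j *: ((-1) ^ (i%:Z - j%:Z + 1) *: delta_mx (rev_ord j) (rev_ord i)).

Lemma phiE (K : fieldType) (n i j : nat) :
  (1 <= i <= n)%N -> (1 <= j <= n)%N ->
  phi (E K n i j) =
    (-1) ^ (i%:Z - j%:Z + 1) *: E K n (n - j + 1)%N (n - i + 1)%N.
Proof.
case: i => // i; case: j => // j /= lti ltj.
rewrite /phi (bigD1 (Ordinal lti)) //= [X in _ + X]big1 ?addr0; last first.
  move=> a nea; apply: big1 => b _; rewrite mxE eqSS.
  by rewrite -[i]/(val (Ordinal lti)) val_eqE (negPf nea) scale0r.
rewrite (bigD1 (Ordinal ltj)) //= [X in _ + X]big1 ?addr0; last first.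
  move=> b neb; rewrite mxE !eqSS.
  by rewrite -[j]/(val (Ordinal ltj)) val_eqE (negPf neb) andbF scale0r.
rewrite mxE !eqxx scale1r; congr (_ *: _).
  by rewrite !(intS i) !(intS j) opprD addrACA subrr add0r.
apply/matrixP => a b; rewrite !mxE !addn1 !eqSS.
by rewrite -!val_eqE.
Qed.

Definition so_split (K : fieldType) (n : nat) : {pred 'M[K]_n} :=
  [pred z | (\tr z == 0) && (phi z == z)].

Arguments so_split : clear implicits.

(* Main.v *)
Require Import Defs.
From HB Require Import structures.
From mathcomp Require Import all_boot all_order all_algebra zify ring.
Import GRing.Theory.
Local Open Scope ring_scope.

Set Implicit Arguments.
Unset Strict Implicit.
Unset Printing Implicit Defensive.
Import Order.TTheory Num.Theory.

(* The element y is a lowest root vector of so(n), and ad(x)^(n-3) y is a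
   combination of negative simple root vectors, so g contains diagonal
   elements.  The ad-eigenprojections of such an element map g to itself; they
   break x and ad(x)^(n-3) y into smaller sums of simple root vectors, whose
   brackets are new diagonal elements of g.  Iterating, two simple roots i < j
   that are never told apart satisfy two equations between binomial
   coefficients, which force j to be the short simple root; its neighbours then
   tell it apart from i unless n = 7.  Hence g contains all simple root vectors
   of so(n), and with the lowest root vector these generate so(n).
   For n = 7, g is computed explicitly: it is 14-dimensional, with a diagonal
   element of distinct nonzero values at the twelve roots, so that any nonzero
   ideal contains a root vector and then, by reflections, all of them. *)

(** * Bracket identities and projections onto eigenspaces of [brk a] *)

Section BracketAlgebra.
Variables (K : fieldType) (n : nat).
Implicit Types a b c : 'M[K]_n.

Lemma brkC a b : brk a b = - brk b a.
Proof. by rewrite /brk opprB. Qed.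

Lemma brkDl a b c : brk (a + b) c = brk a c + brk b c.
Proof. by rewrite /brk mulmxDl mulmxDr opprD addrACA. Qed.

Lemma brkDr a b c : brk c (a + b) = brk c a + brk c b.
Proof. by rewrite /brk mulmxDl mulmxDr opprD addrACA. Qed.

End BracketAlgebra.

(** Interpolation: a polynomial p in ad a maps U to itself and multiplies each [e i] by p(lam i).
    Taking p zero at every [lam i] other than c, and nonzero at c, leaves p(c) times the wanted
    partial sum. *)
Lemma eigenprojection (K : fieldType) (n : nat) (U : {vspace 'M[K]_n}) a
    (I : finType) (lam : I -> K) (e : I -> 'M[K]_n) c :
    (forall u, u \in U -> brk a u \in U) ->
    (forall i, brk a (e i) = lam i *: e i) ->
  \sum_i e i \in U -> \sum_(i | lam i == c) e i \in U.
Proof.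
move=> stabU eig_e sumU.
(* Horner's scheme: multiplying p by X applies [brk a], adding a constant adds a multiple of the
   full sum. *)
have polyU (p : {poly K}) : \sum_i p.[lam i] *: e i \in U.
  elim/poly_ind: p => [|p b IH].
    by rewrite big1 ?mem0v // => i _; rewrite horner0 scale0r.
  have := memvD (stabU _ IH) (memvZ b sumU).
  rewrite brk_sumr scaler_sumr -big_split; congr (_ \in U).
  apply: eq_bigr => i _; rewrite /= brkZr eig_e scalerA -scalerDl.
  by rewrite hornerMXaddC.
pose p := \prod_(r <- [seq lam i | i <- enum I] | r != c) ('X - r%:P).
have pc : p.[c] != 0.
  rewrite horner_prod prodf_seq_neq0; apply/allP=> r _; apply/implyP=> rc.
  by rewrite hornerXsubC subr_eq0 eq_sym.
have := memvZ p.[c]^-1 (polyU p); congr (_ \in U).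
rewrite scaler_sumr [RHS]big_mkcond; apply: eq_bigr => i _.
case: eqP => [->|/eqP ne]; first by rewrite scalerA mulVf ?scale1r.
suff -> : p.[lam i] = 0 by rewrite scale0r scaler0.
apply/eqP; rewrite horner_prod prodf_seq_eq0; apply/hasP.
exists (lam i); last by rewrite ne hornerXsubC subrr /=.
by rewrite map_f ?mem_enum.
Qed.


Section DiagonalEigenprojection.
Variables (K : fieldType) (n : nat).
Implicit Types (U : {vspace 'M[K]_n}) (d : 'rV[K]_n) (z : 'M[K]_n).

Lemma brk_diagE d z :
  brk (diag_mx d) z = \matrix_(i, j) ((d 0 i - d 0 j) * z i j).
Proof.
apply/matrixP=> i j; rewrite /brk mul_diag_mx mul_mx_diag !mxE.
by rewrite mulrBl [z i j * _]mulrC.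
Qed.

(** Matrix units are eigenvectors of ad of a diagonal matrix, with the differences of diagonal
    entries as eigenvalues. *)
Lemma diag_eigenprojection U d z c :
    (forall u, u \in U -> brk (diag_mx d) u \in U) -> z \in U ->
  \matrix_(i, j) (if d 0 i - d 0 j == c then z i j else 0) \in U.
Proof.
move=> stabU zU; pose e t := z t.1 t.2 *: delta_mx t.1 t.2 : 'M[K]_n.
have eig t : brk (diag_mx d) (e t) = (d 0 t.1 - d 0 t.2) *: e t.
  rewrite brkZr brk_diagE /e scalerA mulrC -scalerA; congr (_ *: _).
  apply/matrixP=> i j; rewrite !mxE.
  by case: eqP => [->|]; case: eqP => [->|]; rewrite ?mulr0.
have sumE (z' : 'M[K]_n) : z' = \sum_t z' t.1 t.2 *: delta_mx t.1 t.2.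
  by rewrite {1}[z']matrix_sum_delta pair_bigA.
rewrite [z]sumE in zU; have := eigenprojection c stabU eig zU.
congr (_ \in U); rewrite [RHS]sumE big_mkcond; apply: eq_bigr => t _.
by rewrite mxE; case: ifP => // _; rewrite scale0r.
Qed.

End DiagonalEigenprojection.

(** * Separating the simple roots of so(n) *)

Section Binomials.
Variable N : nat.

(** For N = n - 3 these are, up to alternating signs, the subdiagonal entries of ad(x)^N y. *)
Definition ballot (i : nat) : int :=
  'C(N, i)%:Z - (if i is i'.+1 then 'C(N, i')%:Z else 0).

Lemma binZS k : (k.+1)%:Z * 'C(N, k.+1)%:Z = (N%:Z - k%:Z) * 'C(N, k)%:Z.
Proof.
have := mul_bin_left N k; case: (leqP k N) => [kN|Nk] E; last first.
  by rewrite (bin_small Nk) (bin_small (ltnW (Nk : (N.+1 < k.+1)%N))) !mulr0.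
by rewrite -PoszM E PoszM -subzn.
Qed.

Lemma ballot_gt0 i : (i.*2 <= N)%N -> 0 < ballot i.
Proof.
case: i => [|i] le2; rewrite /ballot; first by rewrite bin0 subr0.
have c0 : 0 < 'C(N, i)%:Z by rewrite ltz_nat bin_gt0; lia.
have := binZS i; nia.
Qed.

(** For N = n - 3 this is, up to the sign (-1)^i, the eigenvalue of ad [x, ad(x)^N y] on the matrix
    unit at superdiagonal position i. *)
Definition ballot_sum (i : nat) : int :=
  2 * ballot i + ballot i.+1 + (if i is i'.+1 then ballot i' else 0).

(** By Pascal's rule [ballot_sum i] is the ballot number of N + 2 at i + 1, so its ratio to
    [ballot i] is explicit. *)
Lemma ballot_sumE i :
  ballot_sum i * ((i.+1)%:Z * (N%:Z + 2 - i%:Z))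
  = (N%:Z + 2) * (N%:Z + 1) * ballot i.
Proof.
have zl (a b : int) : a = b -> a - b = 0 by move=> ->; rewrite subrr.
rewrite /ballot_sum /ballot; apply/eqP; rewrite -subr_eq0; apply/eqP.
(* The predecessor terms degenerate at 0 and 1. In each case the difference of the two sides is a
   combination of instances of [binZS]. *)
case: i => [|[|i]].
- transitivity ((N%:Z + 2) * (1%:Z * 'C(N, 1)%:Z - (N%:Z - 0) * 'C(N, 0)%:Z)).
    by rewrite bin0; ring.
  by rewrite (zl _ _ (binZS 0)) mulr0.
- transitivity ((N%:Z + 1) * (2%:Z * 'C(N, 2)%:Z - (N%:Z - 1) * 'C(N, 1)%:Z)
    - (N%:Z + 1) * (1%:Z * 'C(N, 1)%:Z - (N%:Z - 0) * 'C(N, 0)%:Z)).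
    by rewrite bin0; ring.
  by rewrite (zl _ _ (binZS 0)) (zl _ _ (binZS 1)) !mulr0 subrr.
- transitivity ((N%:Z - i%:Z)
    * (i.+3%:Z * 'C(N, i.+3)%:Z - (N%:Z - i.+2%:Z) * 'C(N, i.+2)%:Z)
    - (N%:Z + 1)
    * (i.+2%:Z * 'C(N, i.+2)%:Z - (N%:Z - i.+1%:Z) * 'C(N, i.+1)%:Z)
    + i.+3%:Z
    * (i.+1%:Z * 'C(N, i.+1)%:Z - (N%:Z - i%:Z) * 'C(N, i)%:Z)); first ring.
  by rewrite !binZS !subrr !mulr0 subrr.
Qed.

End Binomials.

(** * Brackets of superdiagonal and subdiagonal matrices *)

Section ShiftMatrices.
Variables (K : fieldType) (n : nat).
Implicit Types w u : nat -> K.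

Definition updiag w : 'M[K]_n :=
  \matrix_(i, j) (if j == i.+1 :> nat then w i else 0).

Definition lowdiag w : 'M[K]_n :=
  \matrix_(i, j) (if i == j.+1 :> nat then w j else 0).

Lemma brk_updiag w (Z : nat -> nat -> K) :
  brk (updiag w) (\matrix_(i, j) Z i j) = \matrix_(i, j)
    ((if (i.+1 < n)%N then w i * Z i.+1 j else 0)
     - (if j : nat is j'.+1 then Z i j' * w j' else 0)).
Proof.
apply/matrixP=> i j; rewrite !mxE; congr (_ - _).
  case: ifP => [lti|gei].
    rewrite (bigD1 (Ordinal lti)) //= big1 => [|k nek];
      rewrite !mxE ?eqxx ?addr0 //.
    by rewrite -[i.+1]/(val (Ordinal lti)) val_eqE (negPf nek) mul0r.
  apply: big1 => k _; rewrite !mxE; case: eqP => [e|]; last by rewrite mul0r.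
  by have := ltn_ord k; rewrite e gei.
case: j => [[|j] ltj] /=.
  by apply: big1 => k _; rewrite !mxE mulr0.
rewrite (bigD1 (Ordinal (ltnW ltj))) //= big1 => [|k nek];
  rewrite !mxE ?eqxx ?addr0 //.
rewrite eqSS eq_sym -[j]/(val (Ordinal (ltnW ltj))) val_eqE (negPf nek).
by rewrite mulr0.
Qed.

(** The subdiagonal uses u only up to n - 2; the hypothesis makes the formula correct at the last
    diagonal entry, where the first product is cut off. *)
Lemma brk_up_low w u : u n.-1 = 0 ->
  brk (updiag w) (lowdiag u) = diag_mx (\row_(i < n)
    (w i * u i - (if i : nat is i'.+1 then w i' * u i' else 0))).
Proof.
move=> un.
rewrite (brk_updiag w (fun i j => if i == j.+1 then u j else 0)).
apply/matrixP=> i j; rewrite !mxE.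
rewrite -val_eqE /= eqSS; case: i j => i lti [j ltj] /=.
case: (eqVneq i j) => [<-|ne].
  rewrite mulr1n; congr (_ - _).
    case: ifP => // /negbT; rewrite -leqNgt => le.
    have -> : i = n.-1 by move: lti le; clear; lia.
    by rewrite un mulr0.
  by case: i {lti ltj} => // i; rewrite eqxx mulrC.
rewrite mulr0 mulr0n if_same sub0r; case: j ne {ltj} => [|j] ne.
  by rewrite oppr0.
by rewrite (negPf ne) mul0r oppr0.
Qed.

End ShiftMatrices.

(** * The iterated brackets ad(x)^k y *)

Section Adjoint.
Variables (K : fieldType) (n : nat).

(** The coefficient of t^j in (1 + t) (1 - t)^k: y itself gives 1 + t, and each bracket with x
    multiplies by 1 - t. *)
Definition adx_coef (k j : nat) : int :=
  (-1) ^+ j * ('C(k, j)%:Z - (if j is j'.+1 then 'C(k, j')%:Z else 0)).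

Lemma adx_coefS k j :
  adx_coef k.+1 j = adx_coef k j - (if j is j'.+1 then adx_coef k j' else 0).
Proof.
rewrite /adx_coef; case: j => [|[|j]]; rewrite ?bin0 ?bin1 ?expr0 ?exprS.
- ring.
- rewrite -addn1 PoszD; ring.
- rewrite !binS !PoszD; ring.
Qed.

Lemma xmxE : (0 < n)%N -> xmx K n = updiag n (fun=> 1).
Proof.
move=> n_gt0; apply/matrixP=> i j; rewrite /xmx summxE mxE.
case: eqP => [e|ne].
  rewrite (big_cat_nat (n := i.+1)) ?(ltnW (ltn_ord i)) //=.
  rewrite big1_seq ?add0r; last first.
    move=> k; rewrite mem_index_iota mxE => /andP[_ ltk].
    by case: eqP => // ?; lia.
  rewrite big_ltn; last by have := ltn_ord j; lia.
  rewrite mxE e !eqxx /= big1_seq ?addr0 // => k.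
  rewrite mem_index_iota mxE => /andP[_ ltk].
  by case: eqP => // ?; lia.
apply: big1 => k _; rewrite mxE; case: eqP => //= <-; case: eqP => //; lia.
Qed.

(* ad(x)^k y, as shown by [ymxE] and [brk_x_adx_y]. *)
Definition adx_y (k : nat) : 'M[K]_n :=
  \matrix_(i, j) (if (i + k.+2 == j + n)%N then (adx_coef k j)%:~R else 0).

Lemma ymxE : (3 < n)%N -> ymx K n = adx_y 0.
Proof.
move=> n_gt3; apply/matrixP=> i [j ltj]; rewrite !mxE /=.
have lti := ltn_ord i; case: j ltj => [|[|j]] ltj; rewrite ?eqSS ?andbT ?andbF.
- rewrite addr0 /adx_coef bin0 expr0 subr0 mul1r.
  have e : (i.+1 == n.-1) = (i + 2 == 0 + n)%N by lia.
  by rewrite e; case: eqP.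
- rewrite add0r /adx_coef bin0 bin0n /= expr1.
  have e : (i.+1 == n) = (i + 2 == 1 + n)%N by lia.
  rewrite e; by case: eqP => // _; rewrite sub0r mulrNN.
- by case: ifP => [|_]; [lia | rewrite addr0].
Qed.

Lemma brk_x_adx_y k : brk (updiag n (fun=> 1)) (adx_y k) = adx_y k.+1.
Proof.
rewrite /adx_y (@brk_updiag K n (fun=> 1) (fun i j =>
  if (i + k.+2 == j + n)%N then (adx_coef k j)%:~R else 0)).
apply/matrixP=> i [j ltj]; rewrite !mxE /= adx_coefS mul1r.
have lti := ltn_ord i.
have -> : (if (i.+1 < n)%N then
      if (i.+1 + k.+2 == j + n)%N then (adx_coef k j)%:~R : K else 0 else 0)
    = if (i + k.+3 == j + n)%N then (adx_coef k j)%:~R else 0.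
  rewrite addSnnS; case: ifP => // gei; case: eqP => // e.
  (* In the last row, where the shifted row does not exist, the column is k + 2 and both binomials
     vanish, so the cut-off changes nothing. *)
  have -> : j = k.+2 by lia.
  by rewrite /adx_coef !bin_small ?subrr ?mulr0 //; lia.
case: j ltj => [|j] ltj; first by rewrite !subr0.
rewrite mulr1 addnS addSn eqSS rmorphB /=.
by case: ifP; rewrite ?subrr.
Qed.

Lemma adx_y_lowdiag k : n = k.+3 ->
  adx_y k = lowdiag n (fun j => (adx_coef k j)%:~R).
Proof.
move=> nE; apply/matrixP=> i j; rewrite !mxE.
have e : (i + k.+2 == j + n)%N = (i == j.+1 :> nat) by lia.
by rewrite e.
Qed.

End Adjoint.

Lemma intr_eq0_pchar0 (K : fieldType) (a : int) :
  [pchar K] =i pred0 -> (a%:~R == 0 :> K) = (a == 0).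
Proof.
move=> /pcharf0P char0; case: a => k; first exact: char0.
by rewrite NegzE mulrNz !oppr_eq0 -pmulrn char0.
Qed.

Lemma intr_eq_pchar0 (K : fieldType) (a b : int) :
  [pchar K] =i pred0 -> (a%:~R == b%:~R :> K) = (a == b).
Proof.
by move=> char0; rewrite -subr_eq0 -rmorphB intr_eq0_pchar0 // subr_eq0.
Qed.

(** * Partial sums of simple root vectors lying in g *)

Section SimpleRootVectors.
Variables (K : fieldType) (n : nat) (g : {vspace 'M[K]_n}).
Hypotheses (char0 : [pchar K] =i pred0) (n_ge5 : (5 <= n)%N) (n_odd : odd n).
Hypotheses (lie_g : lie_subalgebra g) (xg : xmx K n \in g) (yg : ymx K n \in g).

Let N := (n - 3)%N.
Let c := adx_coef N.
Implicit Types P Q : pred nat.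

Definition cut P (i : nat) : int := if P i then c i else 0.

(** The eigenvalue of the diagonal element [[raising P], [lowering P]] on the matrix unit at
    superdiagonal position i. *)
Definition cartan_eigenvalue P (i : nat) : int :=
  2 * cut P i - cut P i.+1 - (if i is i'.+1 then cut P i' else 0).

Definition raising P : 'M[K]_n := updiag n (fun i => (P i)%:R).
Definition lowering P : 'M[K]_n := lowdiag n (fun i => (cut P i)%:~R).

(* Positions on the superdiagonal are counted from 0; i and n-2-i carry the
   same simple root of so(n). *)
Definition separated P : Prop :=
  [/\ forall i, (i <= n - 2)%N -> P (n - 2 - i)%N = P i,
      raising P \in g & lowering P \in g].

(** N is even, so (1 + t) (1 - t)^N is a palindromic polynomial of degree N + 1 = n - 2. *)
Let c_sym i : (i <= n - 2)%N -> c (n - 2 - i)%N = c i.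
Proof.
move=> lei; have nN : n = N.+3 by rewrite /N; lia.
have -> : (n - 2 - i = N.+1 - i)%N by lia.
have {}lei : (i <= N.+1)%N by lia.
have oddN : odd N = false by move: n_odd; rewrite nN /=; case: odd.
rewrite /c /adx_coef.
have -> : (-1) ^+ (N.+1 - i) = - (-1) ^+ i :> int.
  rewrite -signr_odd oddB //= oddN -[in RHS]signr_odd.
  by case: odd; rewrite ?expr0 ?opprK.
case: i lei => [|i] lei.
  by rewrite subn0 bin_small // binn bin0; ring.
rewrite subSS.
case: (eqVneq i N) => [->|ne].
  by rewrite subnn bin0 binn bin_small //; ring.
have -> : (N - i = (N - i.+1).+1)%N by lia.
rewrite bin_sub; last by lia.
have -> : ((N - i.+1).+1 = N - i)%N by lia.
by rewrite bin_sub; [ring | lia].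
Qed.

Let c_last : c n.-1 = 0.
Proof.
have -> : n.-1 = N.+2 by rewrite /N; lia.
by rewrite /c /adx_coef !bin_small // subrr mulr0.
Qed.

Definition coroot P : 'rV[K]_n :=
  \row_i (cut P i - (if i : nat is i'.+1 then cut P i' else 0))%:~R.

Let brk_raising_lowering P : brk (raising P) (lowering P) = diag_mx (coroot P).
Proof.
rewrite /raising /lowering brk_up_low; last by rewrite /cut c_last if_same.
congr diag_mx; apply/rowP=> i; rewrite !mxE rmorphB /=.
have pc k : (P k)%:R * (cut P k)%:~R = (cut P k)%:~R :> K.
  by rewrite /cut; case: (P k); rewrite ?mul1r ?mul0r.
by rewrite pc; case: (val i) => [|j]; rewrite ?pc.
Qed.

Let coroot_diff P (i j : 'I_n) : j = i.+1 :> nat ->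
  coroot P 0 i - coroot P 0 j = (cartan_eigenvalue P i)%:~R.
Proof.
move=> ji; rewrite !mxE ji /cartan_eigenvalue -rmorphB /=.
by congr (_ %:~R); ring.
Qed.

Lemma cut_sym P i : separated P -> (i <= n - 2)%N -> cut P (n - 2 - i) = cut P i.
Proof. by move=> [symP _ _] le_i; rewrite /cut symP ?c_sym. Qed.

Let cartan_eigenvalue_sym P i : separated P -> (i <= n - 2)%N ->
  cartan_eigenvalue P (n - 2 - i) = cartan_eigenvalue P i.
Proof.
move=> sepP.
(* Reflection moves the predecessor term from k - 1 to n - 1 - k; at k = 0 this is position n - 1,
   where c vanishes. *)
have E k : (k <= n - 2)%N ->
    cartan_eigenvalue P k = 2 * cut P k - cut P k.+1 - cut P (n.-1 - k)%N.
  move=> le_k; rewrite /cartan_eigenvalue; congr (_ - _).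
  case: k le_k => [|k] le_k; first by rewrite subn0 /cut c_last if_same.
  by rewrite -(cut_sym sepP) ?(ltnW le_k) //; congr (cut P _); lia.
move=> le_i; rewrite !E ?leq_subr // cut_sym //.
have -> : (n - 2 - i).+1 = (n.-1 - i)%N by lia.
have -> : (n.-1 - (n - 2 - i))%N = i.+1 by lia.
ring.
Qed.

(** The diagonal element [[raising Q], [lowering Q]] lies in g; its eigenprojections for l and -l
    cut [raising P] and [lowering P] down to the same positions. In characteristic 0 integer
    eigenvalues are compared as integers. *)
Lemma separated_level P Q l : separated P -> separated Q ->
  separated (fun i => P i && (cartan_eigenvalue Q i == l)).
Proof.
move=> [symP upP lowP] sepQ; have [_ upQ lowQ] := sepQ.
have ad_stable u : u \in g -> brk (diag_mx (coroot Q)) u \in g.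
  by move=> ug; apply: lie_g ug; rewrite -brk_raising_lowering; apply: lie_g.
split=> [i le_i||]; first by rewrite symP ?cartan_eigenvalue_sym.
  have := diag_eigenprojection l%:~R ad_stable upP; congr (_ \in g).
  apply/matrixP=> i j; rewrite [RHS]mxE [LHS]mxE [raising P i j]mxE.
  case: (eqVneq (j : nat) i.+1) => [ji|_]; last by rewrite if_same.
  by rewrite coroot_diff // intr_eq_pchar0 //; case: eqP; rewrite ?andbT ?andbF.
have := diag_eigenprojection (- l%:~R) ad_stable lowP; congr (_ \in g).
apply/matrixP=> i j; rewrite [RHS]mxE [LHS]mxE [lowering P i j]mxE.
case: (eqVneq (i : nat) j.+1) => [ij|_]; last by rewrite if_same.
rewrite -opprB coroot_diff // eqr_opp intr_eq_pchar0 // /cut.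
by case: eqP; rewrite ?andbT ?andbF.
Qed.

(** The two vectors are here x and ad(x)^(n-3) y. *)
Lemma separated_all : separated predT.
Proof.
have x_up : xmx K n = updiag n (fun=> 1) by apply: xmxE; lia.
split=> //; first by rewrite /raising -x_up.
rewrite /lowering /cut /c -adx_y_lowdiag; last by rewrite /N; lia.
elim: N => [|k IH]; first by rewrite -ymxE //; lia.
by rewrite -brk_x_adx_y; apply: lie_g IH; rewrite -x_up.
Qed.

End SimpleRootVectors.

Definition simple_index (n i : nat) : pred nat :=
  fun k => (k == i) || (k == n - 2 - i)%N.

(** * Isolating each simple root of so(n) for m different from 3 *)

Section Isolation.
Variables (K : fieldType) (m : nat).
Let n := (2 * m + 1)%N.
Variable g : {vspace 'M[K]_n}.
Hypotheses (char0 : [pchar K] =i pred0) (m_ge2 : (2 <= m)%N) (m_ne3 : m <> 3%N).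
Hypotheses (lie_g : lie_subalgebra g) (xg : xmx K n \in g) (yg : ymx K n \in g).

Let N := (n - 3)%N.
Let n_ge5 : (5 <= n)%N. Proof. rewrite /n; lia. Qed.
Let n_odd : odd n. Proof. by rewrite /n oddD oddM. Qed.
Let nE : n = (2 * m + 1)%N. Proof. by []. Qed.
Let sep := @separated K n g.
Let eig := @cartan_eigenvalue n.
Let c := adx_coef N.
Implicit Types (P Q : pred nat) (i k : nat).

Let signz i : (-1) ^+ i = (if odd i then -1 else 1) :> int.
Proof. by rewrite -signr_odd; case: odd. Qed.

Let ballot_pos i : (i < m)%N -> 0 < ballot N i.
Proof. by move=> ltim; apply: ballot_gt0; rewrite /N /n; lia. Qed.

Let c_neq0 i : (i < m)%N -> c i != 0.
Proof.
move=> /ballot_pos; rewrite /c /adx_coef -/(ballot N i) signz; case: odd; lia.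
Qed.

Let ballot_sum_pos i : (i < m)%N -> 0 < ballot_sum N i.
Proof.
move=> ltim; have N2m : (N = m.*2 - 2)%N by rewrite /N /n; lia.
have den_gt0 : 0 < i.+1%:Z * (N%:Z + 2 - i%:Z) by apply: mulr_gt0; lia.
rewrite -(pmulr_lgt0 _ den_gt0) ballot_sumE pmulr_rgt0 ?ballot_pos //.
by apply: mulr_gt0; lia.
Qed.

Let eig_all i : eig predT i = (-1) ^+ i * ballot_sum N i.
Proof.
rewrite /eig /cartan_eigenvalue /cut /= /adx_coef /ballot_sum.
rewrite -!/(ballot N _) -/(ballot N i.+1) -/(ballot N i) -/N.
case: i => [|i]; rewrite ?exprS ?expr0; first by ring.
by rewrite -/(ballot N i); ring.
Qed.

(** Ballot sums are positive below m, so the sign of the eigenvalue gives the parity and its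
    absolute value the sum. *)
Let eig_all_inj i j : (i < m)%N -> (j < m)%N -> eig predT i = eig predT j ->
  odd i = odd j /\ ballot_sum N i = ballot_sum N j.
Proof.
move=> /ballot_sum_pos Ai /ballot_sum_pos Aj; rewrite !eig_all !signz.
by case: odd; case: odd => E; split=> //; lia.
Qed.

(** By [ballot_sumE] the hypotheses give (i + 1) (N + 2 - i) = (j + 1) (N + 2 - j), that is, (i - j)
    (N + 1 - i - j) = 0, and i + j <= 2m - 2 = N makes the second factor positive. *)
Let same_ballot i j : (i < m)%N -> (j < m)%N ->
  ballot_sum N i = ballot_sum N j -> ballot N i = ballot N j -> i = j.
Proof.
move=> ltim ltjm eA eb; have := ballot_sumE N j; rewrite -eA -eb -ballot_sumE.
move=> /(mulfI (lt0r_neq0 (ballot_sum_pos ltim))).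
have N2m : (N = m.*2 - 2)%N by rewrite /N /n; lia.
rewrite !intS => E; have : (i%:Z - j%:Z) * (N%:Z + 1 - i%:Z - j%:Z) = 0 by lia.
by move/eqP; rewrite mulf_eq0 => /orP[] /eqP; lia.
Qed.

(** The positions that [x, ad(x)^(n-3) y] does not tell from i; [level2] refines them by the
    diagonal element built from [level1 i] itself. *)
Let level1 i k := predT k && (eig predT k == eig predT i).
Let level2 i k := level1 i k && (eig (level1 i) k == eig (level1 i) i).

Let sep_level1 i : sep (level1 i).
Proof.
apply: (separated_level char0 n_ge5 n_odd lie_g xg yg);
  exact: (separated_all n_ge5 n_odd lie_g xg yg).
Qed.

Let sep_level2 i : sep (level2 i).
Proof.
have sep1 := sep_level1 i.
exact: (separated_level char0 n_ge5 n_odd lie_g xg yg _ sep1 sep1).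
Qed.

(** The reflection exchanges the two middle positions m - 1 and m, which carry the short simple
    root. *)
Let cut_mid P : sep P -> cut n P m = cut n P m.-1.
Proof.
move=> sepP; have {1}-> : m = (n - 2 - m.-1)%N :> nat by rewrite /n; lia.
by apply: (cut_sym n_ge5 n_odd xg yg sepP); rewrite /n; lia.
Qed.

Let level1_parity i k : (i < m)%N -> (k < m)%N -> level1 i k -> odd k = odd i.
Proof. by move=> ltim ltkm /= /eqP /(eig_all_inj ltkm ltim)[]. Qed.

(** Members of [level1 i] below m share their parity, so neither neighbour of k contributes. The
    bound on k excludes m - 1, whose neighbour m carries the same root. *)
Let eig_level1 i k : (i < m)%N -> (k.+1 < m)%N -> level1 i k ->
  eig (level1 i) k = 2 * c k.
Proof.
move=> ltim ltkm kS; have par := level1_parity ltim (ltnW ltkm) kS.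
have nk1 : level1 i k.+1 = false.
  by apply/negP=> /(level1_parity ltim ltkm) /=; rewrite par; case: odd.
rewrite /eig /cartan_eigenvalue /cut kS nk1.
case: k ltkm kS par nk1 => [|k] ltkm kS par _.
  by rewrite !subr0.
suff -> : level1 i k = false by rewrite !subr0.
apply/negP=> /(level1_parity ltim (ltnW (ltnW ltkm))); rewrite -par /=.
by case: odd.
Qed.

(** The first level gives equal ballot sums, the second, through 2 c k = 2 c i, equal ballot
    numbers; [same_ballot] then applies. *)
Let level2_sub i k : (i.+1 < m)%N -> (k.+1 < m)%N -> level2 i k -> k = i.
Proof.
move=> ltim ltkm /andP[kS]; have iS : level1 i i by rewrite /level1 eqxx.
rewrite !eig_level1 ?(ltnW ltim) // => /eqP /(mulfI (isT : 2 != 0 :> int)).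
have par := level1_parity (ltnW ltim) (ltnW ltkm) kS.
rewrite /c /adx_coef -/(ballot N k) -/(ballot N i) !signz par => eb.
have {}eb : ballot N k = ballot N i by case: odd eb; lia.
move: kS => /eqP /(eig_all_inj (ltnW ltkm) (ltnW ltim))[_ eA].
exact: same_ballot (ltnW ltkm) (ltnW ltim) eA eb.
Qed.

(** Positions from m to n - 2 are governed by the symmetry contained in [sep]. *)
Let isolates P i := sep P /\ forall k, (k < m)%N -> P k = (k == i).

(** The only possible intruder, m - 1, has the wrong parity. *)
Let isolates_level2 i : (i.+1 < m)%N -> odd i != odd m.-1 ->
  isolates (level2 i) i.
Proof.
move=> ltim par; split=> [|k ltkm]; first exact: sep_level2.
apply/idP/eqP=> [kS|->]; last by rewrite /level2 /level1 !eqxx.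
case: (ltnP k.+1 m) => [lt|ge]; first exact: level2_sub ltim lt kS.
have ek : k = m.-1 by lia.
case/andP: kS => /(level1_parity (ltnW ltim) ltkm) e _.
by rewrite -e ek eqxx in par.
Qed.

(* Besides i, [level2 i] can contain only the short simple root m-1; a
   neighbour of one of the two tells them apart unless m = 3. *)
Let isolated i : (i.+1 < m)%N -> exists P, isolates P i.
Proof.
move=> ltim; case: (eqVneq (odd i) (odd m.-1)) => [par|]; last first.
  by exists (level2 i); apply: isolates_level2.
suff [Q [sepQ neQ]] : exists Q, sep Q /\ eig Q m.-1 != eig Q i.
  exists (fun k => level2 i k && (eig Q k == eig Q i)); split.
    exact: (separated_level char0 n_ge5 n_odd lie_g xg yg) (sep_level2 i) sepQ.
  move=> k ltkm; apply/idP/eqP=> [/andP[kS eQ]|->]; last first.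
    by rewrite /level2 /level1 !eqxx.
  case: (ltnP k.+1 m) => [lt|ge]; first exact: level2_sub ltim lt kS.
  have ek : k = m.-1 by lia.
  by rewrite -ek eQ in neQ.
have lt3 : (i.+3 <= m)%N by move: par; case: m ltim => [|[|[|k]]] //; lia.
case: (eqVneq i.+3 m) => [e3|ne3].
  (* Here i = m - 3, and i = 0 would mean m = 3. The common neighbour m - 2 has the same effect on i
     and m - 1, so the other neighbour i - 1 is used: it is not adjacent to m - 1. *)
  case: i par ltim lt3 e3 => [|i] par ltim lt3 e3; first by case: m_ne3.
  have [sepQ Qk] : isolates (level2 i) i.
    apply: isolates_level2; first by lia.
    by rewrite -par /=; case: odd.
  exists (level2 i); split=> //.
  rewrite /eig /cartan_eigenvalue (prednK (ltnW m_ge2)) cut_mid //.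
  rewrite -e3 /cut /= !Qk; try lia.
  have -> : (i.+3 == i) = false by lia.
  have -> : (i.+2 == i) = false by lia.
  have -> : (i.+1 == i) = false by lia.
  rewrite eqxx; have : c i != 0 by apply: c_neq0; lia.
  by rewrite /c /N; lia.
have lt4 : (i.+3 < m)%N by lia.
(* Now i < m - 3, so the neighbour q = m - 2 of the short root is neither i nor adjacent to it. *)
have [q [mq qm]] : exists q, m = q.+2 /\ m.-1 = q.+1 by exists m.-2; lia.
have [sepQ Qk] : isolates (level2 q) q.
  apply: isolates_level2; first by lia.
  by rewrite qm /=; case: odd.
exists (level2 q); split=> //.
rewrite /eig /cartan_eigenvalue (prednK (ltnW m_ge2)) cut_mid // qm.
rewrite /cut !Qk; try lia.
have -> : (q.+1 == q) = false by lia.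
have -> : (i.+1 == q) = false by lia.
have -> : (i == q) = false by lia.
have -> : (if i is i'.+1 then
    if level2 q i' then adx_coef (n - 3) i' else 0 else 0) = 0.
  case: (i) lt4 => [|j] lt4 //; rewrite Qk; last by lia.
  have -> // : (j == q) = false by lia.
rewrite eqxx; have : c q != 0 by apply: c_neq0; lia.
by rewrite /c /N; lia.
Qed.



Let simple := simple_index n.

(** Below m - 1 this comes from [isolated]; the short simple root vector is what remains of x after
    subtracting all the others. *)
Lemma raising_simple i : (i < m)%N -> raising K n (simple i) \in g.
Proof.
have gt i' : (i'.+1 < m)%N -> raising K n (simple i') \in g.
  move=> /[dup] ltim /isolated[P [[symP Pg _] Pk]].
  move: Pg; congr (_ \in g); apply/matrixP=> a b; rewrite !mxE.
  case: eqP => // ba; congr (_ %:R); have ltb := ltn_ord b; rewrite ba in ltb.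
  congr nat_of_bool; rewrite /simple /simple_index; case: (ltnP a m) => [lt|ge].
    by rewrite Pk // [X in _ || X](_ : _ = false) ?orbF //; lia.
  by rewrite -symP ?Pk; lia.
case: (ltnP i.+1 m) => [/gt //|ge] ltim; have {ltim ge} -> : i = m.-1 by lia.
have [_ allg _] := separated_all n_ge5 n_odd lie_g xg yg.
have sumg : \sum_(j < m.-1) raising K n (simple j) \in g.
  by apply: memv_suml => j _; apply: gt; have := ltn_ord j; lia.
have := memvB allg sumg; congr (_ \in g); apply/matrixP=> a b.
rewrite !mxE summxE; under eq_bigr do rewrite mxE.
case: eqP => [ba|_]; last by rewrite big1 ?subr0.
have ltb := ltn_ord b; rewrite ba in ltb.
(* The representative below m of the position a under the reflection. *)
pose a' := minn a (n - 2 - a); have lta' : (a' < m)%N by rewrite /a'; lia.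
have simpleE j : (j < m)%N -> simple j a = (a' == j).
  by move=> ltjm; rewrite /simple /simple_index /a'; lia.
rewrite simpleE; last by lia.
have -> : \sum_(j < m.-1) (simple j a)%:R
    = \sum_(j < m.-1) (a' == j)%:R :> K.
  by apply: eq_bigr => j _; rewrite simpleE //; have := ltn_ord j; lia.
case: eqP => [a'm|ne].
  rewrite big1 ?subr0 // => j _; have ltj := ltn_ord j.
  have -> // : (a' == j) = false by lia.
have lta : (a' < m.-1)%N by lia.
rewrite (bigD1 (Ordinal lta)) //= eqxx big1 ?addr0 ?subrr // => j.
by rewrite -val_eqE eq_sym /= => /negPf->.
Qed.

End Isolation.

(** * Generation of so(n) by simple root vectors *)

Section Phi.
Variables (K : fieldType) (n : nat).
Implicit Types z u v : 'M[K]_n.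

Lemma signz_subn1 (a b : nat) :
  (-1) ^ (a%:Z - b%:Z + 1) = (-1) ^+ (a + b).+1 :> K.
Proof.
have N1 : (-1 : K) != 0 by rewrite oppr_eq0 oner_eq0.
rewrite !expfzDr // expr1z exprS exprD mulrC; congr (_ * (_ * _)).
by rewrite -invr_expz exprnP -exprVn invrN1.
Qed.

Lemma phi_coef z a b :
  phi z a b = (-1) ^+ (a + b).+1 * z (rev_ord b) (rev_ord a).
Proof.
rewrite /phi summxE (bigD1 (rev_ord b)) //= summxE (bigD1 (rev_ord a)) //=.
rewrite big1 => [|j nej]; last first.
  rewrite !mxE -{1}[a]rev_ordK (inj_eq rev_ord_inj) eq_sym (negPf nej).
  by rewrite !mulr0.
rewrite big1 => [|i nei]; last first.
  rewrite summxE big1 // => j _.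
  rewrite !mxE -{1}[b]rev_ordK (inj_eq rev_ord_inj) [_ == i]eq_sym (negPf nei).
  by rewrite andbF !mulr0.
rewrite !mxE !rev_ordK !eqxx !addr0 mulr1 mulrC -signz_subn1; congr (_ ^ _ * _).
by have [lta ltb] := (ltn_ord a, ltn_ord b); lia.
Qed.

Lemma phiD u v : phi (u + v) = phi u + phi v.
Proof. by apply/matrixP=> i j; rewrite !mxE !phi_coef !mxE mulrDr. Qed.

Lemma phiN u : phi (- u) = - phi u.
Proof. by apply/matrixP=> i j; rewrite !mxE !phi_coef !mxE mulrN. Qed.

Lemma phiZ c u : phi (c *: u) = c *: phi u.
Proof. by apply/matrixP=> i j; rewrite !mxE !phi_coef !mxE mulrCA. Qed.

Lemma phiK : involutive (@phi K n).
Proof.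
move=> z; apply/matrixP=> i j; rewrite !phi_coef !rev_ordK mulrA -exprD.
rewrite -signr_odd.
have -> : odd ((i + j).+1 + (rev_ord j + rev_ord i).+1) = false.
  have [lti ltj] := (ltn_ord i, ltn_ord j); apply/negbTE; rewrite -dvdn2 /=; lia.
by rewrite mul1r.
Qed.

(** Minus [phi] is thus an anti-automorphism of the matrix algebra, which makes [phi] an
    automorphism of the bracket. *)
Lemma phi_mul u v : phi (u *m v) = - (phi v *m phi u).
Proof.
apply/matrixP=> i j; rewrite phi_coef !mxE mulr_sumr -sumrN.
rewrite (reindex_inj rev_ord_inj) /=; apply: eq_bigr => k _.
rewrite !phi_coef [u _ _ * _]mulrC mulrACA -exprD -mulNr; congr (_ * _).
rewrite -signr_odd -[in RHS]signr_odd !oddS !oddD !oddS !oddD /=.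
by case: (odd i); case: (odd j); case: (odd k); rewrite ?expr0 ?expr1 ?opprK.
Qed.

Lemma phi_brk u v : phi (brk u v) = brk (phi u) (phi v).
Proof. by rewrite /brk phiD phiN !phi_mul opprK addrC. Qed.

Lemma phi_is_linear : linear (@phi K n).
Proof. by move=> a u v; rewrite phiD phiZ. Qed.

HB.instance Definition _ :=
  GRing.isLinear.Build K 'M[K]_n 'M[K]_n *:%R (@phi K n) phi_is_linear.

Definition phi_fixed : {vspace 'M[K]_n} := fixedSpace (linfun (@phi K n)).

Lemma phi_fixedP z : reflect (phi z = z) (z \in phi_fixed).
Proof. by apply: (iffP fixedSpaceP); rewrite lfunE. Qed.

Lemma lie_phi_fixed : lie_subalgebra phi_fixed.
Proof.
move=> u v /phi_fixedP uF /phi_fixedP vF.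
by apply/phi_fixedP; rewrite phi_brk uF vF.
Qed.

Lemma trace_phi z : \tr (phi z) = - \tr z.
Proof.
rewrite /mxtrace (reindex_inj rev_ord_inj) -sumrN; apply: eq_bigr => i _.
by rewrite phi_coef rev_ordK -signr_odd /= addnn odd_double mulN1r.
Qed.

(** [phi] negates the trace, so twice the trace of a fixed matrix is 0. *)
Lemma so_splitE z : 2 != 0 :> K -> (z \in so_split K n) = (z \in phi_fixed).
Proof.
move=> char2; apply/idP/phi_fixedP=> [/andP[_ /eqP] //|phiz].
rewrite inE phiz eqxx andbT; have := trace_phi z; rewrite phiz => /eqP.
by rewrite -subr_eq0 opprK -mulr2n -mulr_natl mulf_eq0 (negPf char2).
Qed.

End Phi.

(** * Matrix units symmetrized by [phi] *)

Section MatrixUnits.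
Variables (K : fieldType) (n : nat).

Lemma mul_E i j k l : (1 <= j <= n)%N ->
  E K n i j *m E K n k l = (j == k)%:R *: E K n i l.
Proof.
case: j => // j /= ltj; apply/matrixP=> a b; rewrite !mxE.
rewrite (bigD1 (Ordinal ltj)) //= big1 ?addr0 => [|c nec]; rewrite !mxE /=.
  by rewrite eqxx; do 3!case: (_ == _); rewrite ?mulr1 ?mulr0 ?mul0r.
by rewrite eqSS -[j]/(val (Ordinal ltj)) val_eqE (negPf nec) andbF mul0r.
Qed.

Lemma phi_E i j : (1 <= i <= n)%N -> (1 <= j <= n)%N ->
  phi (E K n i j) = (-1) ^+ (i + j).+1 *: E K n (n - j + 1) (n - i + 1).
Proof. by move=> iP jP; rewrite phiE // signz_subn1. Qed.

Definition sym_phi (z : 'M[K]_n) := z + phi z.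

Lemma phi_sym z : phi (sym_phi z) = sym_phi z.
Proof. by rewrite /sym_phi phiD phiK addrC. Qed.

Lemma brk_sym u v :
  brk (sym_phi u) (sym_phi v) = sym_phi (brk u v + brk u (phi v)).
Proof.
rewrite /sym_phi !(brkDl, brkDr) phiD !phi_brk phiK; congr (_ + _).
by rewrite addrC.
Qed.

Definition soE i j := sym_phi (E K n i j).

(** The two inequalities make e_(i,i+1) commute with phi(e_(a,b)), a multiple of e_(n-b+1,n-a+1), so
    only the bracket of the plain matrix units survives. *)
Lemma brk_soE i a b : (1 <= i < n)%N -> (1 <= a <= n)%N -> (1 <= b <= n)%N ->
    (b + i != n)%N -> (a + i != n.+1)%N ->
  brk (soE i i.+1) (soE a b) =
    (i.+1 == a)%:R *: soE i b - (b == i)%:R *: soE a i.+1.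
Proof.
move=> iP aP bP nebi neai; rewrite /soE brk_sym phi_E //.
rewrite /brk -scalemxAl -scalemxAr !mul_E; try lia.
have -> : (i.+1 == n - b + 1)%N = false by lia.
have -> : (n - a + 1 == i)%N = false by lia.
rewrite !scale0r scaler0 subrr addr0 /sym_phi phiD phiN !phiZ !scalerDr opprD.
exact: addrACA.
Qed.

End MatrixUnits.

(** * From simple root vectors and y to all of so(n) *)

Section Span.
Variables (K : fieldType) (n : nat) (g : {vspace 'M[K]_n}).
Hypotheses (n_odd : odd n) (n_ge5 : (5 <= n)%N) (lie_g : lie_subalgebra g).
Hypothesis simple_g : forall i, (1 <= i < n)%N -> soE K n i i.+1 \in g.
Hypothesis y_g : ymx K n \in g.
Local Notation F := (soE K n).

Let n_half : exists m, n = m.*2.+1.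
Proof. by exists n./2; rewrite -{1}[n]odd_double_half n_odd. Qed.

(** Descending induction on the row, starting at F(n-1,1) = y: the bracket of F(a-1,a) with F(a,1)
    is F(a-1,1). *)
Let F_col1 a : (1 < a < n)%N -> F a 1 \in g.
Proof.
have [m nm] := n_half.
move=> aP; rewrite -[a](subKn (n := n.-1)); last by lia.
have : (n.-1 - a <= n - 3)%N by lia.
elim: (n.-1 - a)%N => {a aP} [_|k IH le_k].
  suff -> : F (n.-1 - 0) 1 = ymx K n by [].
  rewrite /soE /sym_phi /ymx phi_E; try lia.
  have -> : (n - 1 + 1 = n)%N by lia.
  have -> : (n - (n.-1 - 0) + 1 = 2)%N by lia.
  rewrite subn0 -signr_odd.
  have -> : odd (n.-1 + 1).+1 = false by rewrite nm addn1 /= odd_double.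
  by rewrite scale1r.
have eS : (n.-1 - k = (n.-1 - k.+1).+1)%N by lia.
have sP : (1 <= n.-1 - k.+1 < n)%N by lia.
have := lie_g (simple_g sP) (IH (ltnW le_k)); rewrite eS brk_soE; try lia.
rewrite eqxx scale1r; have -> : (1 == n.-1 - k.+1)%N = false by lia.
by rewrite scale0r subr0.
Qed.

(** Induction on the column: the bracket of F(b,b+1) with F(a,b) is -F(a,b+1); for a = b the new
    vector is itself a simple root vector. Oddness of n excludes 2b = n in [brk_soE]. *)
Let F_upper b : (0 < b)%N ->
  forall a, (0 < a)%N -> a != b -> (a + b <= n)%N -> F a b \in g.
Proof.
have [m nm] := n_half.
elim: b => // -[|b] IH _ a a_gt0 ne le_ab; first by apply: F_col1; lia.
case: (eqVneq a b.+1) => [->|ne']; first by apply: simple_g; lia.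
have Fab : F a b.+1 \in g by apply: IH; lia.
have sP : (1 <= b.+1 < n)%N by lia.
have := lie_g (simple_g sP) Fab; rewrite brk_soE; try lia.
have -> : (b.+2 == a) = false by lia.
by rewrite scale0r eqxx scale1r sub0r memvN.
Qed.

(** [phi] sends each antidiagonal matrix unit to its negative, since n is odd. *)
Let F_anti a b : (0 < a)%N -> (0 < b)%N -> (a + b)%N = n.+1 -> F a b = 0.
Proof.
move=> a_gt0 b_gt0 ab; rewrite /soE /sym_phi phi_E; try lia.
have -> : (n - b + 1)%N = a by lia.
have -> : (n - a + 1)%N = b by lia.
by rewrite ab -signr_odd /= n_odd scaleN1r subrr.
Qed.

(** Descending induction from the centre, where F vanishes by [F_anti]: the bracket of F(b,b+1) with
    F(b+1,b) is F(b,b) - F(b+1,b+1). *)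
Let F_diag b : (0 < b)%N -> (b.*2 <= n.+1)%N -> F b b \in g.
Proof.
have [m nm] := n_half.
move=> b_gt0 le_b; rewrite -[b](subKn (n := m.+1)); last by lia.
have : (m.+1 - b <= m)%N by lia.
elim: (m.+1 - b)%N => {b b_gt0 le_b} [_|k IH le_k].
  by rewrite subn0 F_anti ?mem0v; lia.
have eS : (m.+1 - k = (m.+1 - k.+1).+1)%N by lia.
have Fk : F (m.+1 - k) (m.+1 - k.+1) \in g by apply: F_upper; lia.
have sP : (1 <= m.+1 - k.+1 < n)%N by lia.
have := lie_g (simple_g sP) Fk; rewrite eS brk_soE; try lia.
rewrite -eS !eqxx !scale1r => FB.
by rewrite -[F _ _](subrK (F (m.+1 - k) (m.+1 - k))) memvD // IH // ltnW.
Qed.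

(** Past the antidiagonal, F(a,b) is up to sign F(n-b+1,n-a+1), which lies before it. *)
Let F_all a b : (1 <= a <= n)%N -> (1 <= b <= n)%N -> F a b \in g.
Proof.
have low a' b' : (0 < a')%N -> (0 < b')%N -> (a' + b' <= n)%N -> F a' b' \in g.
  move=> a_gt0 b_gt0 le_ab; case: (eqVneq a' b') => [e|ne]; last exact: F_upper.
  by rewrite e; apply: F_diag; lia.
move=> aP bP; case: (ltngtP (a + b) n.+1) => ab; first by apply: low; lia.
  rewrite /soE -phi_sym /sym_phi phiD phi_E // phiZ -scalerDr.
  by apply/memvZ/low; lia.
by rewrite F_anti ?mem0v; lia.
Qed.

Lemma phi_fixed_sub : 2 != 0 :> K -> (phi_fixed K n <= g)%VS.
Proof.
move=> char2; apply/subvP=> z /phi_fixedP phiz.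
have -> : z = 2^-1 *: sym_phi z.
  by rewrite /sym_phi phiz -mulr2n -scaler_nat scalerA mulVf ?scale1r.
apply: memvZ; rewrite [z]matrix_sum_delta /sym_phi linear_sum -big_split.
apply: memv_suml => i _; rewrite linear_sum -big_split.
apply: memv_suml => j _; rewrite /= linearZ -scalerDr; apply: memvZ.
have -> : delta_mx i j = E K n i.+1 j.+1.
  by apply/matrixP=> a b; rewrite !mxE !eqSS.
by apply: F_all; apply: ltn_ord.
Qed.

End Span.

Lemma soE_raising (K : fieldType) (n i : nat) : (i.+1 < n)%N -> odd n ->
  soE K n i.+1 i.+2 = raising K n (simple_index n i).
Proof.
move=> ltin n_odd; rewrite /soE /sym_phi phi_E; try lia.
rewrite -signr_odd.
have -> : odd (i.+1 + i.+2).+1 = false.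
  by rewrite addSn !addnS addnn /= odd_double.
rewrite expr0 scale1r.
apply/matrixP=> a b; rewrite !mxE.
have nm : n = n./2.*2.+1 by rewrite -{1}[n]odd_double_half n_odd.
have -> : (b.+1 == n - i.+1 + 1)%N = (b.+1 == n - i)%N by lia.
have -> : (a.+1 == n - i.+2 + 1)%N = (a == n - 2 - i :> nat)%N by lia.
rewrite !eqSS /simple_index; case: (eqVneq (b : nat) a.+1) => ba.
  have -> : (b.+1 == n - i)%N = (a == n - 2 - i :> nat)%N by lia.
  have -> : (b == i.+1 :> nat) = (a == i :> nat)%N by lia.
  rewrite !andbb; case: eqP => ai; case: eqP => a2;
    rewrite ?addr0 ?add0r //; lia.
have -> : (a == i :> nat) && (b == i.+1 :> nat) = false by lia.
have -> : (a == n - 2 - i :> nat)%N && (b.+1 == n - i)%N = false by lia.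
by rewrite addr0.
Qed.

(** * The generated algebra for n different from 7 *)

Section OddOrthogonal.
Variables (K : fieldType) (m : nat).
Let n := (2 * m + 1)%N.
Hypotheses (char0 : [pchar K] =i pred0) (m_ge2 : (2 <= m)%N).
Let g := lie_gen (xmx K n) (ymx K n).

Let n_odd : odd n. Proof. by rewrite /n oddD oddM. Qed.
Let nE : n = (2 * m + 1)%N. Proof. by []. Qed.

Let char2 : 2 != 0 :> K.
Proof. by rewrite (intr_eq0_pchar0 2 char0). Qed.

Lemma lie_gen_sub_phi_fixed : (g <= phi_fixed K n)%VS.
Proof.
have [_ _ _ min] := lie_genP (xmx K n) (ymx K n).
apply: min; first exact: lie_phi_fixed.
  apply/phi_fixedP; apply/matrixP=> i j; rewrite phi_coef xmxE ?nE ?addn1 //.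
  rewrite !mxE -signr_odd.
  have [lti ltj] := (ltn_ord i, ltn_ord j).
  have -> : (rev_ord i == (rev_ord j).+1 :> nat) = (j == i.+1 :> nat).
    by rewrite /=; lia.
  case: eqP => [->|]; last by rewrite mulr0.
  by rewrite addnS addnn /= odd_double mul1r.
apply/phi_fixedP.
have -> : ymx K n = soE K n n.-1 1.
  rewrite /soE /sym_phi /ymx phi_E; try lia.
  have -> : (n - 1 + 1 = n)%N by lia.
  have -> : (n - n.-1 + 1 = 2)%N by lia.
  rewrite -signr_odd; have -> : odd (n.-1 + 1).+1 = false.
    by rewrite nE mul2n !addn1 /= odd_double.
  by rewrite scale1r.
exact: phi_sym.
Qed.

Lemma lie_gen_so : m <> 3%N -> g =i so_split K n.
Proof.
move=> m_ne3 z; rewrite so_splitE //; suff -> : g = phi_fixed K n by [].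
have [lie_g xg yg _] := lie_genP (xmx K n) (ymx K n).
apply/eqP; rewrite eqEsubv lie_gen_sub_phi_fixed.
apply: phi_fixed_sub => //; first by lia.
move=> [//|i] /= ltin; rewrite soE_raising //.
have simple_g := raising_simple char0 m_ge2 m_ne3 lie_g xg yg.
case: (ltnP i m) => [/simple_g //|ge].
(* The reflected position n - 2 - i lies below m and carries the same simple root. *)
suff -> : raising K n (simple_index n i)
    = raising K n (simple_index n (n - 2 - i)).
  by apply: simple_g; lia.
apply/matrixP=> a b; rewrite !mxE; case: eqP => // ba.
congr (_ %:R); congr nat_of_bool.
by rewrite /simple_index; lia.
Qed.

End OddOrthogonal.

(** * The case n = 7 *)

(* [v 12] and [v 13] are the diagonal coordinates; for k < 12 the coordinate
   [v k] belongs to the k-th root in [g2_weights]. *)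
Definition g2_rows (R : pzRingType) (v : nat -> R) : seq (seq R) :=
  [::
   [:: v 12; v 0; v 2; - 2 * v 1; v 3; v 11; 0];
   [:: v 6; v 13; v 4; - v 2; v 1; 0; v 11];
   [:: v 8; v 10; v 12 - v 13; v 0; 0; v 1; - v 3];
   [:: v 7; - 2 * v 8; 2 * v 6; 0; v 0; v 2; - 2 * v 1];
   [:: v 9; - v 7; 0; 2 * v 6; - v 12 + v 13; v 4; - v 2];
   [:: v 5; 0; - v 7; 2 * v 8; v 10; - v 13; v 0];
   [:: 0; v 5; - v 9; v 7; - v 8; v 6; - v 12]].

(** Structure constants in the 14 coordinates. They are integers, so brackets can be computed over
    the integers and then mapped to K. *)
Definition g2_bracket (R : comPzRingType) (u v : nat -> R) : seq R :=
  let w i j := u i * v j - u j * v i in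
  [::
   - w 0 12 + w 0 13 + 4 * w 1 8 + w 2 10 - w 3 7;
   w 0 2 - w 1 12 - w 3 6 + w 8 11;
   w 0 4 - 4 * w 1 6 - w 2 13 + w 7 11;
   3 * w 0 1 - 2 * w 3 12 + w 3 13 - w 10 11;
   - 3 * w 2 6 + w 4 12 - 2 * w 4 13 + w 9 11;
   w 5 12 + w 5 13 - 3 * w 7 8 - w 9 10;
   w 1 9 - w 2 7 + w 4 8 + w 6 12 - w 6 13;
   w 0 9 + w 2 5 + 4 * w 6 8 + w 7 12;
   w 0 7 + w 1 5 - w 6 10 + w 8 13;
   w 4 5 + 3 * w 6 7 + 2 * w 9 12 - w 9 13;
   - 3 * w 0 8 - w 3 5 - w 10 12 + 2 * w 10 13;
   - 3 * w 1 2 + w 3 4 - w 11 12 - w 11 13;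
   w 0 6 - 2 * w 1 7 + w 2 8 + w 3 9 - w 5 11;
   - w 0 6 - w 1 7 + 2 * w 2 8 + w 4 10 - w 5 11].

Lemma map_g2_bracket (R S : comPzRingType) (f : {rmorphism R -> S}) u v :
  map f (g2_bracket u v) = g2_bracket (f \o u) (f \o v).
Proof.
by rewrite /g2_bracket /=; do 14!(congr (_ :: _); first ring).
Qed.

(** * The 14-dimensional algebra in coordinates *)

Section G2Matrices.
Variable K : fieldType.
Implicit Types (u v : nat -> K) (z : 'M[K]_7).

Definition g2_mx v : 'M[K]_7 := \matrix_(i, j) nth 0 (nth [::] (g2_rows v) i) j.

(** Each coordinate is read at an entry of [g2_rows] where it stands alone with coefficient 1. *)
Definition g2_coord z : nat -> K := nth 0
  [:: z (inord 0) (inord 1); z (inord 1) (inord 4); z (inord 0) (inord 2);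
      z (inord 0) (inord 4); z (inord 1) (inord 2); z (inord 5) (inord 0);
      z (inord 1) (inord 0); z (inord 3) (inord 0); z (inord 2) (inord 0);
      z (inord 4) (inord 0); z (inord 2) (inord 1); z (inord 0) (inord 5);
      z (inord 0) (inord 0); z (inord 1) (inord 1)].

Lemma g2_mxK v k : (k < 14)%N -> g2_coord (g2_mx v) k = v k.
Proof.
move=> ltk; rewrite /g2_coord /g2_mx !mxE !inordK //.
by do 14!(case: k ltk => [|k] ltk //).
Qed.

Lemma eq_g2_mx u v : (forall k, (k < 14)%N -> u k = v k) -> g2_mx u = g2_mx v.
Proof.
move=> e; suff E : g2_rows u = g2_rows v by rewrite /g2_mx E.
by rewrite /g2_rows !e.
Qed.

Lemma g2_mxP (z : 'M[K]_7) v :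
  (forall i j, (i < 7)%N -> (j < 7)%N ->
     z (inord i) (inord j) = nth 0 (nth [::] (g2_rows v) i) j) -> z = g2_mx v.
Proof.
move=> e; apply/matrixP=> i j; rewrite mxE -(e i j) ?inord_val //.
Qed.

Lemma brk_g2 u v : brk (g2_mx u) (g2_mx v) = g2_mx (nth 0 (g2_bracket u v)).
Proof.
apply: g2_mxP => i j lti ltj; rewrite /brk !mxE.
(* With entries indexed by natural numbers the sums unfold, leaving 49 polynomial identities. *)
pose f a b := nth 0 (nth [::] (g2_rows u) a) b.
pose h a b := nth 0 (nth [::] (g2_rows v) a) b.
have -> : \sum_(k < 7) g2_mx u (inord i) k * g2_mx v k (inord j)
  = \sum_(0 <= k < 7) f i k * h k j.
  by rewrite big_mkord; apply: eq_bigr => k _; rewrite !mxE !inordK.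
have -> : \sum_(k < 7) g2_mx v (inord i) k * g2_mx u k (inord j)
  = \sum_(0 <= k < 7) h i k * f k j.
  by rewrite big_mkord; apply: eq_bigr => k _; rewrite !mxE !inordK.
rewrite /f /h unlock /=.
by case: i lti => [|[|[|[|[|[|[|//]]]]]]] _;
  case: j ltj => [|[|[|[|[|[|[|//]]]]]]] _; rewrite /=; ring.
Qed.

End G2Matrices.

(* Coordinates of the roots in the basis of the first two diagonal entries,
   listed in the order of [G2_roots]. *)
Definition g2_weights : seq (int * int) :=
  [:: (1, -1); (1, 0); (0, 1); (2, -1); (-1, 2); (-1, -1);
      (-1, 1); (-1, 0); (0, -1); (-2, 1); (1, -2); (1, 1); (0, 0); (0, 0)].

(** * The algebra [g2], its torus and its weights *)

Section G2Algebra.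
Variable K : fieldType.
Hypothesis char0 : [pchar K] =i pred0.
Implicit Types (u v : nat -> K) (l : seq int) (z : 'M[K]_7) (s t : K).

Lemma g2_mx_inj u v : g2_mx u = g2_mx v -> forall k, (k < 14)%N -> u k = v k.
Proof. by move=> e k ltk; rewrite -[u k]g2_mxK // e g2_mxK. Qed.

Lemma g2_mxZ c v : c *: g2_mx v = g2_mx (fun k => c * v k).
Proof.
apply: g2_mxP => i j lti ltj; rewrite !mxE !inordK //.
by case: i lti => [|[|[|[|[|[|[|//]]]]]]] _;
  case: j ltj => [|[|[|[|[|[|[|//]]]]]]] _; rewrite /=; ring.
Qed.

Definition g2_vec k : 'M[K]_7 := g2_mx (fun j => (j == k)%:R).

Lemma g2_mx_sum v : g2_mx v = \sum_(k < 14) v k *: g2_vec k.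
Proof.
symmetry; apply: g2_mxP => i j lti ltj; rewrite summxE.
under eq_bigr do rewrite !mxE !inordK //.
rewrite !big_ord_recr big_ord0.
by case: i lti => [|[|[|[|[|[|[|//]]]]]]] _;
  case: j ltj => [|[|[|[|[|[|[|//]]]]]]] _; rewrite /=; ring.
Qed.

Definition g2 : {vspace 'M[K]_7} := <<[seq g2_vec k | k <- iota 0 14]>>%VS.

Lemma g2_vec_mem k : (k < 14)%N -> g2_vec k \in g2.
Proof. by move=> ltk; apply/memv_span/map_f; rewrite mem_iota. Qed.

Lemma mem_g2_mx v : g2_mx v \in g2.
Proof.
by rewrite g2_mx_sum; apply: memv_suml => k _; apply/memvZ/g2_vec_mem.
Qed.

Lemma g2P z : reflect (exists v, z = g2_mx v) (z \in g2).
Proof.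
apply: (iffP idP) => [|[v ->]]; last exact: mem_g2_mx.
pose X := [tuple of map g2_vec (iota 0 14)] => zX.
pose v k := if insub k is Some o then coord X o z else 0.
exists v; rewrite (coord_span (zX : z \in <<X>>%VS)) g2_mx_sum.
apply: eq_bigr => k _.
by rewrite /v valK (nth_map 0%N) ?size_iota // nth_iota.
Qed.

Lemma lie_g2 : lie_subalgebra g2.
Proof.
by move=> a b /g2P[u ->] /g2P[v ->]; rewrite brk_g2; apply: mem_g2_mx.
Qed.

Definition g2_int l : 'M[K]_7 := g2_mx (fun k => (nth 0 l k)%:~R).

Lemma brk_g2_int l l' :
  brk (g2_int l) (g2_int l') = g2_int (g2_bracket (nth 0 l) (nth 0 l')).
Proof.
rewrite /g2_int brk_g2; apply: eq_g2_mx => k ltk.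
rewrite -(nth_map 0 0 (fun a : int => a%:~R : K)) //.
by rewrite (@map_g2_bracket int K intr).
Qed.

Definition g2_unit k : seq int := mkseq (fun j => (j == k)%:Z) 14.

Lemma g2_vecE k : g2_vec k = g2_int (g2_unit k).
Proof. by apply: eq_g2_mx => j ltj; rewrite nth_mkseq //; case: eqP. Qed.

Definition g2_cartan s t : 'M[K]_7 :=
  g2_mx (fun k => if k == 12%N then s else if k == 13%N then t else 0).

Definition weight k s t : K :=
  (nth (0, 0) g2_weights k).1%:~R * s + (nth (0, 0) g2_weights k).2%:~R * t.

Lemma brk_g2_cartan s t v :
  brk (g2_cartan s t) (g2_mx v) = g2_mx (fun k => weight k s t * v k).
Proof.
rewrite /g2_cartan brk_g2; apply: eq_g2_mx => k ltk.
by do 14?(case: k ltk => [|k] ltk //); rewrite /weight /=; ring.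
Qed.

Lemma g2_cartan_vec s t k :
  brk (g2_cartan s t) (g2_vec k) = weight k s t *: g2_vec k.
Proof.
rewrite brk_g2_cartan g2_mxZ; apply: eq_g2_mx => j _.
by case: (eqVneq j k) => [->|]; rewrite ?mulr0.
Qed.

(* The values of the twelve roots at this element are distinct and nonzero. *)
Definition g2_regular : 'M[K]_7 := g2_cartan 1 (- 4).

Definition regular_value k : int :=
  (nth (0, 0) g2_weights k).1 - 4 * (nth (0, 0) g2_weights k).2.

Lemma weight_regular k : weight k 1 (- 4) = (regular_value k)%:~R.
Proof. by rewrite /weight /regular_value rmorphB rmorphM /=; ring. Qed.

Lemma regular_value_inj k j : (k < 12)%N -> (j < 14)%N ->
  (regular_value j == regular_value k) = (j == k).
Proof.
have: all (fun k => all (fun j =>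
    (regular_value j == regular_value k) == (j == k)) (iota 0 14)) (iota 0 12).
  by vm_compute.
move=> /allP H ltk ltj; move: (H k); rewrite mem_iota => /(_ ltk).
by move=> /allP /(_ j); rewrite mem_iota => /(_ ltj) /eqP.
Qed.

(** The k-th root is determined by its value at the regular element, so this eigenprojection leaves
    the single term [v k *: g2_vec k]. *)
Lemma g2_vec_in (U : {vspace 'M[K]_7}) v k :
    (forall a, a \in U -> brk g2_regular a \in U) ->
  g2_mx v \in U -> (k < 12)%N -> v k != 0 -> g2_vec k \in U.
Proof.
rewrite g2_mx_sum => stabU vU ltk vk.
have eig (i : 'I_14) : brk g2_regular (v i *: g2_vec i)
    = (regular_value i)%:~R *: (v i *: g2_vec i).
  by rewrite brkZr g2_cartan_vec weight_regular !scalerA mulrC.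
have := eigenprojection (regular_value k)%:~R stabU eig vU.
have ltk14 : (k < 14)%N by apply: ltn_trans ltk _.
rewrite (bigD1 (Ordinal ltk14)) //= big1 ?addr0 => [|i].
  by move=> /(memvZ (v k)^-1); rewrite scalerA mulVf ?scale1r.
rewrite intr_eq_pchar0 // regular_value_inj // => /andP[/eqP e /eqP[]].
exact: val_inj.
Qed.

End G2Algebra.

(** Positions 0 and 4 of [g2_weights] are the short and the long simple root, position 5 is the
    lowest root. *)
Definition x_coord : seq int := [:: 1; 0; 0; 0; 1].
Definition y_coord : seq int := [:: 0; 0; 0; 0; 0; 1].

Definition adx_y_coord k : seq int :=
  iter k (fun l => g2_bracket (nth 0 x_coord) (nth 0 l)) y_coord.

Lemma all_iotaP (p : pred nat) n :
  all p (iota 0 n) -> forall k, (k < n)%N -> p k.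
Proof. by move=> /allP H k ltk; apply: H; rewrite mem_iota. Qed.

(** * Generation and simplicity of [g2] *)

Section G2Type.
Variable K : fieldType.
Hypothesis char0 : [pchar K] =i pred0.
Implicit Types (u v : nat -> K) (z a b : 'M[K]_7) (s t : K).

Lemma g2_mx_neq0 v k : (k < 14)%N -> v k != 0 -> g2_mx v != 0.
Proof.
move=> ltk; apply: contraNneq => v0.
have : g2_mx v = g2_mx (fun k => 0 * v k) by rewrite -g2_mxZ v0 scaler0.
by move/g2_mx_inj => -> //; rewrite mul0r.
Qed.

Lemma g2_vec_neq0 k : (k < 14)%N -> g2_vec K k != 0.
Proof. by move=> ltk; apply: (@g2_mx_neq0 _ k); rewrite ?eqxx ?oner_eq0. Qed.

Lemma xmx7 : xmx K 7 = g2_int K x_coord.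
Proof.
rewrite xmxE //; apply: g2_mxP => i j lti ltj; rewrite mxE !inordK //.
by case: i lti => [|[|[|[|[|[|[|//]]]]]]] _;
  case: j ltj => [|[|[|[|[|[|[|//]]]]]]] _; rewrite /=; ring.
Qed.

Lemma ymx7 : ymx K 7 = g2_int K y_coord.
Proof.
apply: g2_mxP => i j lti ltj; rewrite !mxE !inordK //.
by case: i lti => [|[|[|[|[|[|[|//]]]]]]] _;
  case: j ltj => [|[|[|[|[|[|[|//]]]]]]] _; rewrite /=; ring.
Qed.

(** Indices 3 and 9, like 4 and 10 in [g2_vec13], are opposite long roots. *)
Lemma g2_vec12 : g2_vec K 12 = brk (g2_vec K 3) (g2_vec K 9).
Proof. by rewrite !g2_vecE brk_g2_int; congr (g2_int _ _); vm_compute. Qed.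

Lemma g2_vec13 : g2_vec K 13 = brk (g2_vec K 4) (g2_vec K 10).
Proof. by rewrite !g2_vecE brk_g2_int; congr (g2_int _ _); vm_compute. Qed.

Lemma g2_sub (U : {vspace 'M[K]_7}) :
  (forall k, (k < 12)%N -> g2_vec K k \in U) ->
  g2_vec K 12 \in U -> g2_vec K 13 \in U -> (g2 K <= U)%VS.
Proof.
move=> rU U12 U13; apply/span_subvP=> _ /mapP[k + ->].
rewrite mem_iota /= => ltk; case: (ltnP k 12) => [/rU //|ge].
have : k = 12%N \/ k = 13%N by lia.
by case=> ->.
Qed.

Lemma lie_gen_g2 : lie_gen (xmx K 7) (ymx K 7) = g2 K.
Proof.
have [lie_g xg yg min] := lie_genP (xmx K 7) (ymx K 7).
set g := lie_gen _ _ in lie_g xg yg min *.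
have adx_g k : g2_int K (adx_y_coord k) \in g.
  elim: k => [|k IH]; first by rewrite -ymx7.
  by rewrite /adx_y_coord iterS -brk_g2_int -xmx7; apply: lie_g.
have regg : g2_regular K \in g.
  (* The lowest root has height -5, so ad(x)^5 y is diagonal; its coordinates are those chosen for
     [g2_regular]. *)
  have E : adx_y_coord 5 = [:: 0; 0; 0; 0; 0; 0; 0; 0; 0; 0; 0; 0; 1; - 4].
    by vm_compute.
  by have := adx_g 5%N; rewrite E.
have stab a : a \in g -> brk (g2_regular K) a \in g by apply: lie_g.
(* Each root coordinate is nonzero in some ad(x)^i y, from which the regular element extracts the
   root vector. *)
have reach : forall k, (k < 12)%N ->
    has (fun i => nth 0 (adx_y_coord i) k != 0) (iota 0 12).
  by apply: all_iotaP; vm_compute.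
have root_g k : (k < 12)%N -> g2_vec K k \in g.
  move=> ltk; have /hasP[i _ nz] := reach k ltk.
  by apply: (g2_vec_in char0 stab (adx_g i)) => //; rewrite intr_eq0_pchar0.
apply/eqP; rewrite eqEsubv min; first last.
- by rewrite ymx7; apply: mem_g2_mx.
- by rewrite xmx7; apply: mem_g2_mx.
- exact: lie_g2.
apply: g2_sub => //; first by rewrite g2_vec12; apply: lie_g; apply: root_g.
by rewrite g2_vec13; apply: lie_g; apply: root_g.
Qed.

(** In [g2_weights] the second six roots are the negatives of the first six, in order. *)
Definition opposite k : nat := ((k + 6) %% 12)%N.

(* ad(e_j) ad(e_(-k)) e_k, a nonzero multiple of e_j unless the roots k and j
   are orthogonal. *)
Definition reflected k j : seq int :=
  g2_bracket (nth 0 (g2_unit j))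
    (nth 0 (g2_bracket (nth 0 (g2_unit (opposite k))) (nth 0 (g2_unit k)))).

Lemma lie_simple_g2 : lie_simple (g2 K).
Proof.
split; first exact: lie_g2.
  exists (g2_cartan 1 0), (g2_vec K 1).
  rewrite mem_g2_mx g2_vec_mem // g2_cartan_vec; split=> //.
  by rewrite /weight /= mulr1 mulr0 addr0 scale1r g2_vec_neq0.
move=> J [subJ idJ].
have stab a : a \in J -> brk (g2_regular K) a \in J.
  by apply: idJ; apply: mem_g2_mx.
have link k j : g2_vec K k \in J -> (k < 12)%N -> (j < 12)%N ->
    nth 0 (reflected k j) j != 0 -> g2_vec K j \in J.
  move=> kJ ltk ltj nz.
  have memJ : g2_int K (reflected k j) \in J.
    rewrite /reflected -!brk_g2_int -!g2_vecE; apply/idJ/idJ => //.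
      by rewrite g2_vec_mem ?(ltn_trans ltj).
    by rewrite g2_vec_mem // (@ltn_trans 12) // ltn_mod.
  by apply: (g2_vec_in char0 stab memJ) => //; rewrite intr_eq0_pchar0.
(* Some pairs of roots are orthogonal, so k and j are joined through an intermediate root i. *)
have linked : forall k, (k < 12)%N -> all (fun j => has (fun i =>
    [&& (i < 12)%N, nth 0 (reflected k i) i != 0 & nth 0 (reflected i j) j != 0])
    (iota 0 12)) (iota 0 12).
  by apply: all_iotaP; vm_compute.
have one_all k : (k < 12)%N -> g2_vec K k \in J -> J = g2 K.
  move=> ltk kJ; apply/eqP; rewrite eqEsubv subJ.
  have allJ j : (j < 12)%N -> g2_vec K j \in J.
    move=> ltj.
    have /hasP[i _ /and3P[lti ki ij]] := all_iotaP (linked k ltk) ltj.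
    exact: link (link _ _ kJ ltk lti ki) lti ltj ij.
  apply: g2_sub => //.
    by rewrite g2_vec12; apply: idJ; rewrite ?g2_vec_mem ?allJ.
  by rewrite g2_vec13; apply: idJ; rewrite ?g2_vec_mem ?allJ.
case: (eqVneq J 0%VS) => [|nzJ]; [by left | right].
have := memv_pick J; have := nzJ; rewrite -vpick0; set z := vpick J.
move=> nz zJ; have /g2P[v zv] := subvP subJ _ zJ.
case: (boolP [exists k : 'I_12, v k != 0]) => [/existsP[k vk]|].
  by apply: (one_all k (ltn_ord k)); rewrite zv in zJ; apply: g2_vec_in vk.
rewrite negb_exists => /forallP v0.
have zE : z = g2_cartan (v 12) (v 13).
  rewrite zv; apply: eq_g2_mx => k ltk; case: (ltnP k 12) => [lt|ge].
    rewrite (ltn_eqF lt) (ltn_eqF (ltnW lt : (k < 13)%N)); apply/eqP.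
    by have := v0 (Ordinal lt); rewrite negbK.
  by have [->|->] : k = 12%N \/ k = 13%N by lia.
have kJ k : weight k (v 12) (v 13) != 0 -> (k < 14)%N -> g2_vec K k \in J.
  move=> wk ltk; have := idJ _ _ (g2_vec_mem K ltk) zJ.
  rewrite brkC zE g2_cartan_vec memvN => /(memvZ (weight k (v 12) (v 13))^-1).
  by rewrite scalerA mulVf ?scale1r.
(* The roots at positions 1 and 2 read off the two coordinates of the torus element z, so if z is
   nonzero one of their root vectors is in J. *)
have w1 : weight 1 (v 12) (v 13) = v 12 by rewrite /weight /=; ring.
have w2 : weight 2 (v 12) (v 13) = v 13 by rewrite /weight /=; ring.
case: (eqVneq (v 12) 0) => [e12|n12]; last first.
  by apply: (one_all 1%N) => //; apply: kJ; rewrite ?w1.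
case: (eqVneq (v 13) 0) => [e13|n13]; last first.
  by apply: (one_all 2%N) => //; apply: kJ; rewrite ?w2.
have z0 : z = 0 * v 0 *: g2_vec K 0.
  rewrite zE e12 e13 g2_mxZ; apply: eq_g2_mx => k _; rewrite !mul0r.
  by case: eqP => //; case: eqP.
by rewrite z0 mul0r scale0r eqxx in nz.
Qed.

End G2Type.

(** * Cartan subalgebra and root system of [g2] *)

Section G2Cartan.
Variable K : fieldType.
Implicit Types (v : nat -> K) (z a b : 'M[K]_7) (s t p q : K).

Definition g2_h : {vspace 'M[K]_7} := (<[g2_vec K 12]> + <[g2_vec K 13]>)%VS.

Lemma g2_cartanE s t : g2_cartan s t = s *: g2_vec K 12 + t *: g2_vec K 13.
Proof.
rewrite /g2_cartan g2_mx_sum !big_ord_recr big_ord0 /=.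
by rewrite !scale0r !add0r.
Qed.

Lemma g2_hP z : reflect (exists s t, z = g2_cartan s t) (z \in g2_h).
Proof.
apply: (iffP memv_addP) => [[_ /vlineP[s ->] [_ /vlineP[t ->] ->]]|[s [t ->]]].
  by exists s, t; rewrite g2_cartanE.
rewrite g2_cartanE; exists (s *: g2_vec K 12); first by rewrite memvZ ?memv_line.
by exists (t *: g2_vec K 13); rewrite ?memvZ ?memv_line.
Qed.

Lemma weight12 k s t : (12 <= k)%N -> weight k s t = 0.
Proof.
move=> le_k; rewrite /weight.
have -> : nth (0, 0) g2_weights k = (0, 0).
  by do 14?(case: k le_k => [|k] le_k //); rewrite nth_default.
by rewrite !mul0r addr0.
Qed.

Lemma brk_g2_h a b : a \in g2_h -> b \in g2_h -> brk a b = 0.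
Proof.
move=> /g2_hP[s [t ->]] /g2_hP[s' [t' ->]]; rewrite [X in brk _ X]g2_cartanE.
by rewrite brkDr !brkZr !g2_cartan_vec !weight12 // !scale0r !scaler0 addr0.
Qed.

Hypothesis char0 : [pchar K] =i pred0.

(** The torus is abelian. Bracketing a normalizing element with the regular element multiplies its
    root coordinates by nonzero numbers, and the result is in the torus, so these coordinates
    vanish. *)
Lemma cartan_g2_h : cartan_subalgebra (g2 K) g2_h.
Proof.
split.
- by apply/subvP=> _ /g2_hP[s [t ->]]; apply: mem_g2_mx.
- by move=> a b aH bH; rewrite brk_g2_h ?mem0v.
- exists 1%N; apply/eqP; rewrite -subv0; apply: brkv_sub => a b aH bH.
  by rewrite brk_g2_h ?mem0v.
move=> _ /g2P[v ->] normal.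
have /g2_hP[s [t]] : brk (g2_mx v) (g2_regular K) \in g2_h.
  by apply: normal; apply/g2_hP; exists 1, (- 4).
rewrite brkC /g2_regular brk_g2_cartan -scaleN1r g2_mxZ => e.
apply/g2_hP; exists (v 12), (v 13); apply: eq_g2_mx => k ltk.
case: (ltnP k 12) => [lt|ge]; last first.
  by have [->|->] : k = 12%N \/ k = 13%N by lia.
rewrite (ltn_eqF lt) (ltn_eqF (ltnW lt : (k < 13)%N)).
have := g2_mx_inj e ltk.
rewrite (ltn_eqF lt) (ltn_eqF (ltnW lt : (k < 13)%N)) weight_regular.
have nz : (regular_value k)%:~R != 0 :> K.
  rewrite intr_eq0_pchar0 //; move: k lt {ltk}.
  by apply: (all_iotaP (p := fun k => regular_value k != 0)); vm_compute.
by move/eqP; rewrite mulf_eq0 oppr_eq0 oner_eq0 mulf_eq0 (negPf nz) => /eqP.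
Qed.

(** The coordinate vectors form an eigenbasis. *)
Lemma g2_h_triangularizable a : a \in g2_h -> ad_triangularizable (g2 K) a.
Proof.
move=> /g2_hP[s [t ->]]; exists [seq g2_vec K k | k <- iota 0 14].
  rewrite /basis_of eqxx.
  apply/(@freeP _ _ _ [tuple of map (g2_vec K) (iota 0 14)]).
  move=> c c0 i; pose v k := if insub k is Some o then c o else 0.
  have v0 : g2_mx v = 0.
    rewrite g2_mx_sum -[RHS]c0; apply: eq_bigr => k _.
    by rewrite /v valK (nth_map 0%N) ?size_iota // nth_iota.
  have := @g2_mx_neq0 K v i (ltn_ord i); rewrite v0 eqxx /v valK.
  by case: (c i =P 0) => // _ /(_ isT).
move=> i; rewrite size_map size_iota => lti.
rewrite (nth_map 0%N) ?size_iota // nth_iota // g2_cartan_vec memvZ //.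
apply: memv_span; rewrite -map_take; apply: map_f; rewrite take_iota mem_iota /=.
by rewrite ltn_min; lia.
Qed.

(** Identifies the weight (p, q) with a point of the hyperplane of coordinate sum zero that contains
    [G2_roots]. *)
Definition plane_row p q : 'rV[K]_3 := \row_j nth 0 [:: p; q; - p - q] j.

Lemma G2_rootsE : G2_roots K =
  [seq plane_row r.1%:~R r.2%:~R | r <- take 12 g2_weights].
Proof.
rewrite /G2_roots /=; do 12!(congr (_ :: _);
  first by apply/rowP=> j; rewrite !mxE -!val_eqE /= !inordK //;
           case: j => -[|[|[|//]]] ?; rewrite /=; ring).
Qed.

Local Notation H := (subvs_of g2_h).
Let t1 : H := vsproj g2_h (g2_cartan 1 0).
Let t2 : H := vsproj g2_h (g2_cartan 0 1).

Let mem_cartan s t : g2_cartan s t \in g2_h.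
Proof. by apply/g2_hP; exists s, t. Qed.

Lemma form_cartan (alpha : 'Hom(H, K^o)) (a : H) s t :
  vsval a = g2_cartan s t -> alpha a = s * alpha t1 + t * alpha t2.
Proof.
move=> e; have -> : a = s *: t1 + t *: t2.
  apply: subvs_inj; rewrite linearD !linearZ /= !vsprojK // e !g2_cartanE.
  by rewrite !scale0r !scale1r addr0 add0r.
by rewrite linearD !linearZ.
Qed.

Lemma form_eq0 (alpha : 'Hom(H, K^o)) :
  alpha t1 = 0 -> alpha t2 = 0 -> alpha = 0.
Proof.
move=> e1 e2; apply/lfunP=> a; have /g2_hP[s [t e]] := subvsP a.
by rewrite (form_cartan _ e) e1 e2 !mulr0 addr0 lfunE.
Qed.

Definition root_row (alpha : 'Hom(H, K^o)) : 'rV[K]_3 :=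
  plane_row (alpha t1) (alpha t2).

Lemma root_row_is_linear : linear root_row.
Proof.
move=> c alpha beta; apply/rowP=> j; rewrite !mxE !add_lfunE !scale_lfunE.
by case: j => -[|[|[|//]]] ? /=; rewrite /GRing.scale /=; ring.
Qed.

HB.instance Definition _ :=
  GRing.isLinear.Build K 'Hom(H, K^o) 'rV[K]_3 *:%R root_row root_row_is_linear.

(** The first two diagonal entries of [g2_cartan s t] are s and t, so this form takes the values p
    and q at [t1] and [t2]. *)
Definition h_form p q (a : H) : K^o :=
  p * vsval a (inord 0) (inord 0) + q * vsval a (inord 1) (inord 1).

Lemma h_form_is_linear p q : linear (h_form p q).
Proof.
move=> c a b; rewrite /h_form linearP !mxE /GRing.scale /=; ring.
Qed.

HB.instance Definition _ p q :=
  GRing.isLinear.Build K H K^o *:%R (h_form p q) (h_form_is_linear p q).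

Lemma root_row_onto p q : exists alpha, root_row alpha = plane_row p q.
Proof.
exists (linfun (h_form p q)); rewrite /root_row !lfunE /= /h_form !vsprojK //.
congr plane_row; rewrite !mxE !inordK //=; ring.
Qed.

Lemma plane_row_inj p q p' q' :
  plane_row p q = plane_row p' q' -> p = p' /\ q = q'.
Proof.
by move=> /rowP e; have := (e 0, e 1); rewrite !mxE /= => -[].
Qed.

(** An eigenvector has some nonzero coordinate k, and comparing there identifies alpha with the k-th
    weight; alpha being nonzero excludes the two zero weights. Conversely [g2_vec k] is an
    eigenvector. *)
Lemma is_root_weight alpha :
  is_root (g2 K) alpha <->
  exists2 k, (k < 12)%N & root_row alpha =
    plane_row (nth (0, 0) g2_weights k).1%:~R (nth (0, 0) g2_weights k).2%:~R.
Proof.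
split=> [[alpha0 [_ [/g2P[v ->] nz eigv]]]|[k ltk /plane_row_inj[e1 e2]]].
  have [k vk] : exists k : 'I_14, v k != 0.
    apply/existsP; apply: contraNT nz; rewrite negb_exists => /forallP v0.
    rewrite g2_mx_sum big1 // => k _; have := v0 k; rewrite negbK => /eqP->.
    by rewrite scale0r.
  have wk s t : weight k s t = s * alpha t1 + t * alpha t2.
    have := eigv (vsproj g2_h (g2_cartan s t)); rewrite vsprojK // brk_g2_cartan.
    rewrite (@form_cartan _ _ s t) ?vsprojK // g2_mxZ.
    by move=> /g2_mx_inj /(_ k (ltn_ord k)); apply: mulIf.
  have [w1 w2] := (wk 1 0, wk 0 1).
  rewrite /weight !mulr1 !mulr0 !mul1r !mul0r ?addr0 ?add0r in w1 w2.
  exists (val k); last by rewrite /root_row w1 w2.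
  rewrite ltnNge; apply: contraNN alpha0 => ge; apply/eqP; apply: form_eq0.
    by have := wk 1 0; rewrite weight12 // mul1r mul0r addr0.
  by have := wk 0 1; rewrite weight12 // mul1r mul0r add0r.
have ltk14 : (k < 14)%N by apply: ltn_trans ltk _.
split.
  apply/eqP=> a0; rewrite a0 !lfunE /= in e1 e2.
  have : (nth (0, 0) g2_weights k != (0, 0)).
    move: k ltk {ltk14 e1 e2}.
    apply: (all_iotaP (p := fun k => nth (0, 0) g2_weights k != (0, 0))).
    by vm_compute.
  move/esym/eqP: e1; move/esym/eqP: e2; rewrite !intr_eq0_pchar0 //.
  by case: (nth _ _ _) => p q /= /eqP-> /eqP->; rewrite eqxx.
exists (g2_vec K k); split; rewrite ?g2_vec_mem ?g2_vec_neq0 // => a.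
have /g2_hP[s [t e]] := subvsP a.
rewrite (form_cartan _ e) e g2_cartan_vec e1 e2 /weight.
by rewrite [s * _]mulrC [t * _]mulrC.
Qed.

Lemma root_system_g2 : root_system_G2 (g2 K) g2_h.
Proof.
exists (linfun root_row); split.
- apply/eqP; rewrite -subv0; apply/subvP=> alpha.
  rewrite memv_ker lfunE /= => /eqP.
  have -> : 0 = plane_row 0 0.
    apply/rowP=> j; rewrite !mxE.
    by case: j => -[|[|[|//]]] ?; rewrite /= ?subr0 ?oppr0.
  by move=> /plane_row_inj[e1 e2]; rewrite (form_eq0 e1 e2) mem0v.
- apply/eqP; rewrite eqEsubv; apply/andP; split.
    apply/subvP=> _ /memv_imgP[alpha _ ->]; rewrite lfunE /=.
    (* The roots e1 - e3 and e2 - e3 already span the hyperplane. *)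
    have -> : root_row alpha = alpha t1 *: plane_row 1%:~R 0%:~R
        + alpha t2 *: plane_row 0%:~R 1%:~R.
      apply/rowP=> j; rewrite !mxE; case: j => -[|[|[|//]]] ?; rewrite /=; ring.
    by apply: memvD; apply: memvZ; apply: memv_span; rewrite G2_rootsE;
      [apply: (map_f _ (x := (1, 0)))|apply: (map_f _ (x := (0, 1)))].
  apply/span_subvP=> r; rewrite G2_rootsE => /mapP[[p q] _ ->] /=.
  have [alpha <-] := root_row_onto p%:~R q%:~R.
  rewrite -[root_row alpha]/((root_row : {linear _ -> _}) alpha) -lfunE.
  by rewrite memv_img ?memvf.
move=> alpha; rewrite lfunE /= G2_rootsE is_root_weight; split=> [[k ltk ->]|].
  apply: (map_f (fun r : int * int => plane_row r.1%:~R r.2%:~R)).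
  by rewrite -(nth_take _ ltk) mem_nth.
move=> /mapP[r /(nthP (0, 0))[k ltk <-] ->]; exists k; first exact: ltk.
by rewrite nth_take.
Qed.

Lemma simple_of_type_G2_g2 : simple_of_type_G2 (g2 K).
Proof.
split; first exact: lie_simple_g2.
exists g2_h; split; last exact: root_system_g2.
by split; [exact: cartan_g2_h | exact: g2_h_triangularizable].
Qed.

End G2Cartan.

Unset Implicit Arguments.

Theorem proposition2p7 (K : fieldType) (n m : nat)
    (charK : [pchar K] =i pred0)
    (n_odd : n = (2 * m + 1)%N) (n_ge5 : (5 <= n)%N) :
  let g := lie_gen (xmx K n) (ymx K n) in
  (n <> 7%N -> g =i so_split K n) /\ (n = 7%N -> simple_of_type_G2 g).
Proof.
rewrite /=; split=> [ne7|n7]; last first.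
  by clear n_odd; subst n; rewrite lie_gen_g2 //; apply: simple_of_type_G2_g2.
by subst n; apply: lie_gen_so => //; lia.
Qed.
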